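(* Let $f$ be a distortion element of $\mathrm{Diff}^1_0(\mathbb{S}^2)$ having at least three fixed points. Then for every fixed point $z$ of $f$, the derivative $Df(z)$ has $1$ as its unique eigenvalue.
   Context: $\mathrm{Diff}^1_0(\mathbb{S}^2)$ denotes the connected component of the identity in the group of $C^1$-diffeomorphisms of the 2-sphere $\mathbb{S}^2$. An element $f$ of a group $G$ is a distortion element if it has infinite order and there is a finite subset $S\subset G$ such that $f$ lies in the subgroup generated by $S$ and $\lim_{n\to\infty}|f^n|/n=0$, where $|f^n|$ is the word length of $f^n$ with respect to $S$. *)

(* Defs.v *)
From HB Require Import structures.
From mathcomp Require Import all_boot all_order all_algebra.
From mathcomp Require Import all_classical all_reals all_analysis.
Set Implicit Arguments. Unset Strict Implicit. Unset Printing Implicit Defensive.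
Import Order.TTheory GRing.Theory Num.Theory.
Import numFieldNormedType.Exports.
Local Open Scope classical_set_scope.
Local Open Scope ring_scope.

Section Sphere.
Variable R : realType.

Definition V := 'rV[R]_3.
Definition dotp (x y : V) : R := \sum_(i < 3) x ord0 i * y ord0 i.
Definition sphere : set V := [set x | dotp x x = 1].
Definition S2 := {x : V | dotp x x = 1}.
Definition tangent (x v : V) : Prop := dotp x v = 0.

Definition C1ext (U : set V) (g : V -> V) : Prop :=
  [/\ open U, sphere `<=` U, (forall x, U x -> differentiable g x) &
      (forall v x, U x -> {for x, continuous (fun y => 'd g y v)})].

Definition extends (h : S2 -> S2) (U : set V) (g : V -> V) : Prop :=
  C1ext U g /\ forall s : S2, g (proj1_sig s) = proj1_sig (h s).

Definition C1map (h : S2 -> S2) : Prop := exists U g, extends h U g.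

Definition is_diff1 (h : S2 -> S2) : Prop :=
  exists h' : S2 -> S2, [/\ cancel h h', cancel h' h, C1map h & C1map h'].

Definition C1close (h1 h2 : S2 -> S2) (e : R) : Prop :=
  exists U g1 g2, [/\ extends h1 U g1, extends h2 U g2 &
    forall s : S2, `|proj1_sig (h1 s) - proj1_sig (h2 s)| < e /\
      forall v, tangent (proj1_sig s) v -> `|v| <= 1 ->
        `|'d g1 (proj1_sig s) v - 'd g2 (proj1_sig s) v| < e].

Definition C1open (A : set (S2 -> S2)) : Prop :=
  forall h, is_diff1 h -> A h -> exists2 e : R, 0 < e &
    forall h', is_diff1 h' -> C1close h h' e -> A h'.

Definition C1connected (C : set (S2 -> S2)) : Prop :=
  C `<=` is_diff1 /\
  forall A B, C1open A -> C1open B -> C `<=` A `|` B ->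
    C `&` A `&` B = set0 -> C `&` A = set0 \/ C `&` B = set0.

Definition Diff10 (h : S2 -> S2) : Prop :=
  is_diff1 h /\ exists C, [/\ C1connected C, C id & C h].

Definition letter (S : set (S2 -> S2)) (l : S2 -> S2) : Prop :=
  S l \/ exists s, [/\ S s, cancel s l & cancel l s].

Definition wordlen_le (S : set (S2 -> S2)) (h : S2 -> S2) (n : nat) : Prop :=
  exists w : seq (S2 -> S2), [/\ (size w <= n)%N,
    (forall i, (i < size w)%N -> letter S (nth id w i)) &
    foldr (fun a b => a \o b) id w = h].

Definition distortion (f : S2 -> S2) : Prop :=
  [/\ Diff10 f,
      (forall n, (0 < n)%N -> iter n f <> id) &
      exists S : set (S2 -> S2), [/\ finite_set S, S `<=` Diff10,
        (exists n, wordlen_le S f n) &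
        forall e : R, 0 < e -> exists N, forall n, (N <= n)%N ->
          exists k, wordlen_le S (iter n f) k /\ (k%:R <= e * n%:R)]].

End Sphere.

(* Main.v *)
(** Four points [a], [b], [c], [d] of the sphere have a cross ratio, whose
    argument is that of the quaternion [(a - b) (b - d) (d - c) (c - a)]: for
    points of the unit sphere it lies in the complex line spanned by [1] and [a].
    A diffeomorphism close to the identity changes this argument by a small,
    hence well-defined, angle, bounded independently of the four points.  Adding
    these angles along a word of near-identity maps gives the turning of the
    word.  It depends only on the composed map, because it is a continuous lift
    of an argument and vanishes for [b = c].

    Near-identity maps generate the identity component, so if [f] is a
    distortion element then [f ^ n] is a word of length [o(n)] in them, and its
    turning at any four points is [o(n)].  Take three fixed points [z], [c],
    [d], and let [b] tend to [z]: the turning of [f] at [(z, b, c, d)] is then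
    the angle by which [Df(z)] turns the direction of [b - z].  If [Df(z)] had
    no eigenvalue [>= 0] this angle would stay away from [0] and the turning of
    [f ^ n] would grow linearly.  So [Df(z)] has a nonnegative real eigenvalue;
    real eigenvalues have modulus [1], since words of length [o(n)] have
    subexponential Lipschitz constants; and the determinant is positive on the
    identity component.  Hence both eigenvalues are [1]. *)

Require Import Defs.
From HB Require Import structures.
From mathcomp Require Import all_boot all_order all_algebra.
From mathcomp Require Import all_classical all_reals all_analysis.
From mathcomp Require Import ring lra.
Import Order.TTheory GRing.Theory Num.Theory.
Import numFieldNormedType.Exports.
Local Open Scope classical_set_scope.
Local Open Scope ring_scope.

(** * Quaternions and Euclidean vectors *)

Section Quaternions.
Context {R : realType}.

(** Connectedness in [Diff10] is expressed by open sets, so no isotopy is at hand; a word of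
    near-identity maps plays that role. Following a single tangent direction at [z] along the word
    would not give an angle determined by [f]: a full loop of rotations composes to the identity and
    adds [2 pi]. The cross ratio is invariant under rotations, which removes this ambiguity.

    The estimate at [z] holds only in a small disc, which the orbit of [b] may leave. So [n] is
    fixed first and [b] is then taken within [r / M ^ n] of [z], with [M] a Lipschitz constant of
    [f]. Nothing is lost, because the upper bound on the turning of [f ^ n] does not depend on [b].
    The estimate bounds only the absolute value of each turning; the punctured disc being connected,
    the sign is constant and the [n] terms add up instead of cancelling.

    Quaternions give polynomial formulas without a stereographic chart. The cross ratio has four
    factors, and the tolerance [1/10] in [small] is chosen so that [1.1 ^ 4 - 1 < 1/2]. *)

Record quat := Quat {qr : R; qi : R; qj : R; qk : R}.

Definition qmul x y := Quat
  (qr x * qr y - qi x * qi y - qj x * qj y - qk x * qk y)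
  (qr x * qi y + qi x * qr y + qj x * qk y - qk x * qj y)
  (qr x * qj y - qi x * qk y + qj x * qr y + qk x * qi y)
  (qr x * qk y + qi x * qj y - qj x * qi y + qk x * qr y).
Definition qadd x y := Quat (qr x + qr y) (qi x + qi y) (qj x + qj y) (qk x + qk y).
Definition qopp x := Quat (- qr x) (- qi x) (- qj x) (- qk x).
Definition qsub x y := qadd x (qopp y).
Definition qconj x := Quat (qr x) (- qi x) (- qj x) (- qk x).
Definition qscale (r : R) x := Quat (r * qr x) (r * qi x) (r * qj x) (r * qk x).
Definition qdot x y := qr x * qr y + qi x * qi y + qj x * qj y + qk x * qk y.
Definition qnorm x := Num.sqrt (qdot x x).

Lemma qmulA x y z : qmul x (qmul y z) = qmul (qmul x y) z.
Proof. by rewrite /qmul /=; congr Quat; ring. Qed.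

Lemma qdot_ge0 x : 0 <= qdot x x.
Proof. by rewrite /qdot -!expr2 !addr_ge0 ?sqr_ge0. Qed.

Lemma qnorm_ge0 x : 0 <= qnorm x. Proof. exact: sqrtr_ge0. Qed.

Lemma qnorm_sqr x : qnorm x ^+ 2 = qdot x x.
Proof. by rewrite sqr_sqrtr ?qdot_ge0. Qed.

Lemma qdotM x y : qdot (qmul x y) (qmul x y) = qdot x x * qdot y y.
Proof. by rewrite /qdot /qmul /=; ring. Qed.

Lemma qnormM x y : qnorm (qmul x y) = qnorm x * qnorm y.
Proof. by rewrite /qnorm qdotM sqrtrM ?qdot_ge0. Qed.

Lemma qdot_le x y : `|qdot x y| <= qnorm x * qnorm y.
Proof.
rewrite -(@ler_pXn2r _ 2) ?nnegrE ?mulr_ge0 ?qnorm_ge0 ?normr_ge0 //.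
rewrite exprMn !qnorm_sqr real_normK ?num_real // -subr_ge0.
(* Lagrange's identity in dimension four. *)
suff -> : qdot x x * qdot y y - qdot x y ^+ 2 =
   (qr x * qi y - qi x * qr y) ^+ 2 + (qr x * qj y - qj x * qr y) ^+ 2 +
   (qr x * qk y - qk x * qr y) ^+ 2 + (qi x * qj y - qj x * qi y) ^+ 2 +
   (qi x * qk y - qk x * qi y) ^+ 2 + (qj x * qk y - qk x * qj y) ^+ 2.
  by rewrite !addr_ge0 ?sqr_ge0.
by rewrite /qdot; ring.
Qed.

Lemma qnormD x y : qnorm (qadd x y) <= qnorm x + qnorm y.
Proof.
rewrite -(@ler_pXn2r _ 2) ?nnegrE ?addr_ge0 ?qnorm_ge0 //.
rewrite sqrrD !qnorm_sqr.
have -> : qdot (qadd x y) (qadd x y) = qdot x x + qdot x y *+ 2 + qdot y y.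
  by rewrite /qdot /qadd /=; ring.
have := le_trans (ler_norm _) (qdot_le x y); lra.
Qed.

Lemma qsubK x y : qadd (qsub x y) y = x.
Proof. by case: x => *; rewrite /qsub /qadd /qopp /=; congr Quat; ring. Qed.

Definition near_rel (e : R) x x' := qnorm (qsub x' x) <= e * qnorm x.

Lemma near_rel_norm e x x' : near_rel e x x' -> qnorm x' <= (1 + e) * qnorm x.
Proof.
rewrite /near_rel => h; have := qnormD (qsub x' x) x; rewrite qsubK; lra.
Qed.

(** Relative errors compose as the factors [1 + e], through [x' y' - x y = (x' - x) y + x' (y' - y)]
    and the multiplicativity of the norm. *)
Lemma near_rel_mul e1 e2 x x' y y' : 0 <= e1 -> 0 <= e2 ->
  near_rel e1 x x' -> near_rel e2 y y' ->
  near_rel (e1 + e2 + e1 * e2) (qmul x y) (qmul x' y').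
Proof.
move=> e10 e20 hx hy; have hx' := near_rel_norm _ _ _ hx.
rewrite /near_rel.
have -> : qsub (qmul x' y') (qmul x y) =
    qadd (qmul (qsub x' x) y) (qmul x' (qsub y' y)).
  by rewrite /qsub /qadd /qopp /qmul /=; congr Quat; ring.
apply: le_trans (qnormD _ _) _; rewrite !qnormM.
have h1 : qnorm (qsub x' x) * qnorm y <= e1 * qnorm x * qnorm y.
  by rewrite ler_wpM2r ?qnorm_ge0.
have h2 : qnorm x' * qnorm (qsub y' y) <= ((1 + e1) * qnorm x) * (e2 * qnorm y).
  by rewrite ler_pM ?qnorm_ge0.
lra.
Qed.

End Quaternions.

Section Vectors.
Context {R : realType}.
Implicit Types (u v w : V R) (a b c d : S2 R).

Definition k0 : 'I_3 := @Ordinal 3 0 isT.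
Definition k1 : 'I_3 := @Ordinal 3 1 isT.
Definition k2 : 'I_3 := @Ordinal 3 2 isT.

Lemma ord3P (P : 'I_3 -> Prop) : P k0 -> P k1 -> P k2 -> forall i, P i.
Proof.
by move=> h0 h1 h2 [[|[|[|//]]] hi];
  [move: h0|move: h1|move: h2]; congr P; apply: val_inj.
Qed.

Lemma dotpE u v : dotp u v =
  u ord0 k0 * v ord0 k0 + u ord0 k1 * v ord0 k1 + u ord0 k2 * v ord0 k2.
Proof.
rewrite /dotp !big_ord_recl big_ord0 addr0 addrA.
by congr (_ * _ + _ * _ + _ * _); congr (_ _ _); apply: val_inj.
Qed.

Lemma vec3P u v : u ord0 k0 = v ord0 k0 -> u ord0 k1 = v ord0 k1 ->
  u ord0 k2 = v ord0 k2 -> u = v.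
Proof. by move=> *; apply/rowP; apply: ord3P. Qed.

Lemma dotpC u v : dotp u v = dotp v u.
Proof. by rewrite !dotpE; ring. Qed.
Lemma dotpDl u v w : dotp (u + v) w = dotp u w + dotp v w.
Proof. by rewrite !dotpE !mxE; ring. Qed.
Lemma dotpZl (k : R) u v : dotp (k *: u) v = k * dotp u v.
Proof. by rewrite !dotpE !mxE; ring. Qed.
Lemma dotpNl u v : dotp (- u) v = - dotp u v.
Proof. by rewrite !dotpE !mxE; ring. Qed.
Lemma dotpDr u v w : dotp w (u + v) = dotp w u + dotp w v.
Proof. by rewrite !dotpE !mxE; ring. Qed.
Lemma dotpZr (k : R) u v : dotp v (k *: u) = k * dotp v u.
Proof. by rewrite !dotpE !mxE; ring. Qed.
Lemma dotpNr u v : dotp v (- u) = - dotp v u.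
Proof. by rewrite !dotpE !mxE; ring. Qed.
Definition dotpL := (dotpDl, dotpDr, dotpZl, dotpZr, dotpNl, dotpNr).

Lemma dotp_ge0 u : 0 <= dotp u u.
Proof. by rewrite dotpE -!expr2 !addr_ge0 ?sqr_ge0. Qed.

Lemma dotp_eq0 u : (dotp u u == 0) = (u == 0).
Proof.
apply/eqP/eqP => [|->]; last by rewrite dotpE !mxE; ring.
rewrite dotpE -!expr2 => /eqP.
rewrite paddr_eq0 ?addr_ge0 ?sqr_ge0 // paddr_eq0 ?sqr_ge0 // !sqrf_eq0.
by case/andP => /andP[/eqP h0 /eqP h1] /eqP h2; apply: vec3P; rewrite ?mxE.
Qed.

(* The library norm on ['rV_3] is the sup norm; [en] is the Euclidean one. *)
Definition en u : R := Num.sqrt (dotp u u).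
Definition vq u := Quat 0 (u ord0 k0) (u ord0 k1) (u ord0 k2).

Lemma qnorm_vq u : qnorm (vq u) = en u.
Proof. by rewrite /qnorm /en dotpE /qdot /=; congr Num.sqrt; ring. Qed.

Lemma vqB u v : vq (u - v) = qsub (vq u) (vq v).
Proof. by rewrite /vq /qsub /qadd /qopp /= !mxE; congr Quat; ring. Qed.

Lemma en_ge0 u : 0 <= en u. Proof. exact: sqrtr_ge0. Qed.
Lemma en_sqr u : en u ^+ 2 = dotp u u.
Proof. by rewrite sqr_sqrtr ?dotp_ge0. Qed.
Lemma enN u : en (- u) = en u.
Proof. by rewrite /en !dotpL opprK. Qed.
Lemma en_sub u v : en (u - v) = en (v - u).
Proof. by rewrite -enN opprB. Qed.
Lemma enZ (k : R) u : en (k *: u) = `|k| * en u.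
Proof. by rewrite /en !dotpL mulrA -expr2 sqrtrM ?sqr_ge0 // sqrtr_sqr. Qed.
Lemma enD u v : en (u + v) <= en u + en v.
Proof.
rewrite -!qnorm_vq; apply: le_trans _ (qnormD _ _).
by rewrite le_eqVlt; apply/orP; left; apply/eqP; congr qnorm;
  rewrite /vq /qadd /= !mxE; congr Quat; ring.
Qed.
Lemma en_eq0 u : (en u == 0) = (u == 0).
Proof. by rewrite -dotp_eq0 -en_sqr sqrf_eq0. Qed.
Lemma en_gt0 u : (0 < en u) = (u != 0).
Proof. by rewrite lt_neqAle en_ge0 andbT eq_sym en_eq0. Qed.
Lemma dotp_le u v : `|dotp u v| <= en u * en v.
Proof.
rewrite -!qnorm_vq; have := qdot_le (vq u) (vq v).
by rewrite dotpE /qdot /= mul0r add0r.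
Qed.

Lemma coord_le_en u i : `|u ord0 i| <= en u.
Proof.
rewrite -(@ler_pXn2r _ 2) ?nnegrE ?en_ge0 ?normr_ge0 //.
rewrite en_sqr real_normK ?num_real // dotpE.
move: i; apply: ord3P; have := sqr_ge0 (u ord0 k0);
 have := sqr_ge0 (u ord0 k1); have := sqr_ge0 (u ord0 k2); rewrite !expr2; lra.
Qed.

Lemma norm_le_en u : `|u| <= en u.
Proof.
rewrite /Num.norm /= mx_normrE; apply: bigmax_le; first exact: en_ge0.
by move=> [i j] _ /=; rewrite (ord1 i) coord_le_en.
Qed.

Lemma coord_le_norm u i : `|u ord0 i| <= `|u|.
Proof.
rewrite {2}/Num.norm /= mx_normrE.
exact: (le_bigmax _ (fun ij => `|u ij.1 ij.2|) (ord0, i)).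
Qed.

Lemma en_le_norm u : en u <= 2 * `|u|.
Proof.
rewrite -(@ler_pXn2r _ 2) ?nnegrE ?mulr_ge0 ?en_ge0 ?normr_ge0 //.
have h i : u ord0 i * u ord0 i <= `|u| ^+ 2.
  rewrite -expr2 -(real_normK (num_real (u ord0 i))).
  by rewrite ler_pXn2r ?nnegrE ?normr_ge0 // coord_le_norm.
rewrite en_sqr dotpE exprMn; have := sqr_ge0 `|u|.
have := h k0; have := h k1; have := h k2; lra.
Qed.

End Vectors.

(** * Great-circle arcs *)

Section Frames.
Context {R : realType}.
Implicit Types (u v w : V R).

Definition vec3 (x y z : R) : V R := \row_i nth 0 [:: x; y; z] i.

Definition crossp u v := vec3
  (u ord0 k1 * v ord0 k2 - u ord0 k2 * v ord0 k1)
  (u ord0 k2 * v ord0 k0 - u ord0 k0 * v ord0 k2)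
  (u ord0 k0 * v ord0 k1 - u ord0 k1 * v ord0 k0).

Definition triple u v w := dotp u (crossp v w).

Lemma tripleE u v w : triple u v w =
  u ord0 k0 * (v ord0 k1 * w ord0 k2 - v ord0 k2 * w ord0 k1) +
  u ord0 k1 * (v ord0 k2 * w ord0 k0 - v ord0 k0 * w ord0 k2) +
  u ord0 k2 * (v ord0 k0 * w ord0 k1 - v ord0 k1 * w ord0 k0).
Proof. by rewrite /triple dotpE !mxE. Qed.

Lemma unit_sqr u : dotp u u = 1 -> en u = 1.
Proof. by rewrite /en => ->; rewrite sqrtr1. Qed.

Lemma unit_neq0 u : dotp u u = 1 -> u != 0.
Proof. by move=> h; rewrite -dotp_eq0 h oner_eq0. Qed.

Lemma normalized_dotp u : u != 0 -> dotp ((en u)^-1 *: u) ((en u)^-1 *: u) = 1.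
Proof.
move=> u0; rewrite !dotpL -en_sqr mulrA -expr2 -exprMn mulVf ?expr1n //.
by rewrite en_eq0.
Qed.

Lemma exists_orthogonal u : exists w, dotp w w = 1 /\ dotp u w = 0.
Proof.
have [h|h] := eqVneq (vec3 (- u ord0 k1) (u ord0 k0) 0) 0.
  exists (vec3 1 0 0); move/rowP: h => h; have := h k0; have := h k1.
  by rewrite !dotpE !mxE /= => -> _; split; ring.
eexists; split; first exact: (normalized_dotp _ h).
by rewrite dotpZr !dotpE !mxE /=; ring.
Qed.

(** The squared norm of the difference of the two sides is computed; with the Gram determinant for
    the square of the triple product, only polynomial identities remain. *)
Lemma crossp_tangent u v w : dotp u u = 1 -> tangent u v -> tangent u w ->
  crossp v w = triple u v w *: u.
Proof.
rewrite /tangent => u1 uv uw; apply/eqP; rewrite -subr_eq0 -dotp_eq0; apply/eqP.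
have -> : dotp (crossp v w - triple u v w *: u) (crossp v w - triple u v w *: u)
   = dotp v v * dotp w w - dotp v w ^+ 2 - triple u v w ^+ 2 * (2 - dotp u u).
  by rewrite !dotpL /triple !dotpE !mxE /=; ring.
have -> : triple u v w ^+ 2 = dotp v v * dotp u u * dotp w w
    + dotp u v * dotp u w * dotp v w *+ 2
    - dotp v v * dotp u w ^+ 2 - dotp w w * dotp u v ^+ 2
    - dotp u u * dotp v w ^+ 2.
  by rewrite tripleE !dotpE; ring.
by rewrite u1 uv uw; ring.
Qed.

End Frames.

Section Arcs.
Context {R : realType}.
Implicit Types (u v w : V R) (t : R).

Definition gcarc u w t : V R := cos t *: u + sin t *: w.
Definition dgcarc u w t : V R := - sin t *: u + cos t *: w.

Lemma arc0 u w : gcarc u w 0 = u.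
Proof. by rewrite /gcarc cos0 sin0 scale1r scale0r addr0. Qed.

Lemma arc_unit u w t : dotp u u = 1 -> dotp w w = 1 -> dotp u w = 0 ->
  dotp (gcarc u w t) (gcarc u w t) = 1.
Proof.
move=> u1 w1 uw; rewrite !dotpL u1 w1 (dotpC w u) uw -[RHS](cos2Dsin2 t); ring.
Qed.

Lemma darc_unit u w t : dotp u u = 1 -> dotp w w = 1 -> dotp u w = 0 ->
  dotp (dgcarc u w t) (dgcarc u w t) = 1.
Proof.
move=> u1 w1 uw; rewrite !dotpL u1 w1 (dotpC w u) uw -[RHS](cos2Dsin2 t); ring.
Qed.

Lemma darc_tangent u w t : dotp u u = 1 -> dotp w w = 1 -> dotp u w = 0 ->
  tangent (gcarc u w t) (dgcarc u w t).
Proof. by move=> u1 w1 uw; rewrite /tangent !dotpL u1 w1 (dotpC w u) uw; ring. Qed.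

Lemma is_derive_arc u w t : is_derive t (1 : R) (gcarc u w) (dgcarc u w t).
Proof.
have h (k : R -> R) (dk : R) x : is_derive t (1 : R) k dk ->
    is_derive t (1 : R) (fun s => k s *: x) (dk *: x).
  move=> [dk1 dk2]; have dd : differentiable k t by apply/derivable1_diffP.
  split; first by apply/derivable1_diffP; exact: differentiableZl.
  rewrite deriveE; last exact: differentiableZl.
  by rewrite diffZl //= -deriveE // dk2.
have -> : gcarc u w = (fun s => cos s *: u) + (fun s => sin s *: w) by [].
by apply: is_deriveD; apply: h.
Qed.

Lemma is_derive_diff_comp (W : normedModType R) (c : R -> V R) (g : V R -> W) t (c' : V R) :
  is_derive t (1 : R) c c' -> differentiable g (c t) ->
  is_derive t (1 : R) (g \o c) ('d g (c t) c').
Proof.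
move=> [c1 c2] dg; have dc : differentiable c t by apply/derivable1_diffP.
split; first by apply/derivable1_diffP; exact: differentiable_comp.
rewrite deriveE; last exact: differentiable_comp.
by rewrite diff_comp //= -c2 [in RHS]deriveE.
Qed.

Lemma is_derive_coord (c : R -> V R) t (c' : V R) i :
  is_derive t (1 : R) c c' -> is_derive t (1 : R) (fun s => c s ord0 i) (c' ord0 i).
Proof.
move=> [c1 c2]; split; first exact: (derivable_mxP _ _ _).1.
by rewrite -c2 derive_mx // mxE.
Qed.

Lemma norm_coord_le u e : 0 <= e -> (forall i, `|u ord0 i| <= e) -> `|u| <= e.
Proof.
move=> e0 h; rewrite /Num.norm /= mx_normrE; apply: bigmax_le => //.
by move=> [i j] _ /=; rewrite (ord1 i).
Qed.

(** For the sup norm the mean value theorem can be applied to one coordinate at a time without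
    losing a constant. *)
Lemma arc_mvt (G : V R -> V R) u w (e T : R) : 0 <= T -> 0 <= e ->
  (forall t, differentiable G (gcarc u w t)) ->
  (forall t, `|'d G (gcarc u w t) (dgcarc u w t)| <= e) ->
  `|G (gcarc u w T) - G u| <= e * T.
Proof.
move=> T0 e0 dG hG; apply: norm_coord_le; first exact: mulr_ge0.
move=> i; rewrite mxE [X in _ + X]mxE.
have D t : is_derive t (1 : R) (fun s => G (gcarc u w s) ord0 i)
     ('d G (gcarc u w t) (dgcarc u w t) ord0 i).
  apply: is_derive_coord; apply: is_derive_diff_comp => //.
  exact: is_derive_arc.
have [|c _] := @MVT_segment _ (fun s => G (gcarc u w s) ord0 i) _ 0 T T0 (fun x _ => D x).
  by apply: derivable_within_continuous => x _; exact: (@ex_derive _ _ _ _ _ _ _ (D x)).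
rewrite arc0 subr0 => ->; rewrite normrM (ger0_norm T0) ler_wpM2r //.
exact: le_trans (coord_le_norm _ _) _.
Qed.

(** A crude slope suffices: used at half the angle, it bounds an arc by four times its chord. When
    [cos x < 1/4] the sine exceeds [1/2], while [x < 2]. *)
Lemma sin_ge_quarter (x : R) : 0 <= x <= pi / 2 -> x / 4 <= sin x.
Proof.
move=> /andP[x0 x1]; have p2 := pihalf_lt2 R.
have pi0 := pi_gt0 R.
have [h|h] := leP (1 / 4) (cos x); last first.
  have c0 : 0 <= cos x by apply: cos_ge0_pihalf; lra.
  have s0 : 0 <= sin x by apply: sin_ge0_pi; lra.
  have := cos2Dsin2 x; nra.
have [c] := @MVT_segment R sin cos 0 x x0 (fun y _ => is_derive_sin y)
  (continuous_subspaceT (@continuous_sin R)).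
rewrite in_itv /= sin0 !subr0 => /andP[c0 cx] ->.
have : cos x <= cos c.
  by rewrite leNgt; apply/negP; rewrite ltr_cos ?in_itv /=; lra.
nra.
Qed.

Lemma exists_arc u v : dotp u u = 1 -> dotp v v = 1 -> exists w T,
  [/\ dotp w w = 1, dotp u w = 0, 0 <= T, gcarc u w T = v & T <= 4 * en (u - v)].
Proof.
move=> u1 v1; set c := dotp u v.
have c11 : -1 <= c <= 1.
  have := dotp_le u v; rewrite -/c !unit_sqr // mulr1 => h.
  by rewrite -ler_norml.
have cT : cos (acos c) = c by apply: acosK; rewrite in_itv.
have T0 := acos_ge0 c11; have T1 := acos_lepi c11.
have TB : acos c <= 4 * en (u - v).
  have := @sin_ge_quarter (acos c / 2); rewrite ler_pM2r ?invr_gt0 // T1 divr_ge0 // => /(_ isT) h.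
  suff -> : en (u - v) = 2 * sin (acos c / 2) by lra.
  have s0 : 0 <= sin (acos c / 2) by apply: sin_ge0_pi; lra.
  apply/eqP; rewrite -(@eqrXn2 _ 2) ?en_ge0 ?mulr_ge0 //; apply/eqP.
  rewrite en_sqr exprMn sin2cos2 !dotpL u1 v1 (dotpC v u) -/c.
  have := cos_mulr2n (acos c / 2).
  have -> : acos c / 2 *+ 2 = acos c by rewrite -mulr_natr divfK.
  by rewrite cT; lra.
have hd : dotp (v - c *: u) (v - c *: u) = 1 - c ^+ 2.
  by rewrite !dotpL u1 v1 (dotpC v u) -/c; ring.
have st : sin (acos c) = en (v - c *: u) by rewrite sin_acos // /en hd.
have [h|h] := eqVneq (v - c *: u) 0.
  have [w [w1 uw]] := exists_orthogonal u.
  exists w, (acos c); split => //; rewrite /gcarc cT st h.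
  have -> : en 0 = 0 :> R by apply/eqP; rewrite en_eq0.
  by rewrite scale0r addr0; apply/esym/subr0_eq.
exists ((en (v - c *: u))^-1 *: (v - c *: u)), (acos c); split => //.
- exact: normalized_dotp.
- by rewrite !dotpL u1 -/c; ring.
- by rewrite /gcarc cT st scalerA divff ?en_eq0 // scale1r addrC subrK.
Qed.

(** The derivative is controlled only at points of the sphere and in tangent directions, so the mean
    value theorem is used along a great-circle arc and not along the chord; [4] compares their
    lengths. *)
Lemma sphere_lipschitz (G : V R -> V R) (e : R) : 0 <= e ->
  (forall s, dotp s s = 1 -> differentiable G s) ->
  (forall s v, dotp s s = 1 -> tangent s v -> `|v| <= 1 -> `|'d G s v| <= e) ->
  forall u v, dotp u u = 1 -> dotp v v = 1 -> `|G u - G v| <= 4 * e * en (u - v).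
Proof.
move=> e0 dG hG u v u1 v1; have [w [T [w1 uw T0 <- TB]]] := exists_arc _ _ u1 v1.
rewrite distrC; apply: le_trans (arc_mvt _ _ _ e T T0 e0 _ _) _.
- by move=> t; apply: dG; exact: arc_unit.
- move=> t; apply: hG; first exact: arc_unit.
    exact: darc_tangent.
  by apply: le_trans (norm_le_en _) _; rewrite unit_sqr // darc_unit.
- by rewrite [4 * e]mulrC -mulrA ler_wpM2l.
Qed.

End Arcs.

(** * Generation of the identity component by near-identity maps *)

Section Generation.
Context {R : realType}.
Implicit Types (u v : V R) (w : seq (S2 R -> S2 R)) (x y : S2 R) (h k : S2 R -> S2 R).
Local Notation sv x := (proj1_sig x).

Lemma sv_unit x : dotp (sv x) (sv x) = 1. Proof. exact: proj2_sig x. Qed.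

Lemma sv_inj x y : sv x = sv y -> x = y.
Proof. by case: x y => [x px] [y py] /= e; subst y; congr exist; exact: Prop_irrelevance. Qed.

Lemma continuous_dotp (F : V R -> V R) (G : V R -> V R) u :
  {for u, continuous F} -> {for u, continuous G} ->
  {for u, continuous (fun v => dotp (F v) (G v))}.
Proof.
move=> cF cG.
have hF i : {for u, continuous (fun v => F v ord0 i)}.
  by apply: (@continuous_comp _ _ _ F (fun v : V R => v ord0 i)) => //; exact: coord_continuous.
have hG i : {for u, continuous (fun v => G v ord0 i)}.
  by apply: (@continuous_comp _ _ _ G (fun v : V R => v ord0 i)) => //; exact: coord_continuous.
have -> : (fun v => dotp (F v) (G v)) = fun v => F v ord0 k0 * G v ord0 k0 +
    F v ord0 k1 * G v ord0 k1 + F v ord0 k2 * G v ord0 k2.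
  by apply/funext => v; rewrite dotpE.
exact: (cvgD (cvgD (cvgM (hF k0) (hG k0)) (cvgM (hF k1) (hG k1))) (cvgM (hF k2) (hG k2))).
Qed.

Lemma compact_sphere : compact (@sphere R).
Proof.
apply: bounded_closed_compact.
  exists 1; split; first exact: num_real.
  move=> M M1 u u1; apply: le_trans (norm_le_en _) _.
  by rewrite unit_sqr // ltW.
have -> : @sphere R = (fun u : V R => dotp u u) @^-1` [set 1] by [].
apply: closed_comp; last exact: closed_eq.
by move=> u _; apply: (continuous_dotp id id).
Qed.

Lemma sphere_nonempty : @sphere R !=set0.
Proof. by exists (vec3 1 0 0); rewrite /sphere /= dotpE !mxE /=; ring. Qed.

(** [C1ext] makes ['d g] continuous only for each fixed vector, so compactness is used once per
    basis vector and the bounds are added. *)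
Lemma diff_bound (U : set (V R)) (g : V R -> V R) : C1ext U g -> exists2 M : R, 0 <= M &
  forall s v, dotp s s = 1 -> `|v| <= 1 -> `|'d g s v| <= M.
Proof.
move=> [oU sU dg cg].
have hb i : exists M : R, forall s, dotp s s = 1 -> `|'d g s (delta_mx ord0 i)| <= M.
  have [|c _ hc] := EVT_max_rV sphere_nonempty compact_sphere
     (f := fun s => `|'d g s (delta_mx ord0 i)|).
    apply: continuous_in_subspaceT => s /[1!inE] /sU Us.
    by move: (cg (delta_mx ord0 i) s Us) => /cvg_norm.
  by exists (`|'d g c (delta_mx ord0 i)|) => s s1; apply: hc; rewrite inE.
have [M hM] := choice hb.
have M0 i : 0 <= M i.
  by have [s s1] := sphere_nonempty; apply: le_trans (hM i s s1).
exists (\sum_i M i); first exact: sumr_ge0.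
move=> s v s1 v1; rewrite [v in 'd g s v]row_sum_delta linear_sum.
apply: le_trans (ler_norm_sum _ _ _) _; apply: ler_sum => i _.
rewrite linearZ /= normrZ -[leRHS]mul1r ler_pM //; last exact: hM.
exact: le_trans (coord_le_norm _ _) _.
Qed.

Definition lip_le (M : R) h := forall x y, en (sv (h x) - sv (h y)) <= M * en (sv x - sv y).

Lemma C1map_lip h : C1map h -> exists2 M : R, 0 <= M & lip_le M h.
Proof.
move=> [U [g [C1 gh]]]; have [M M0 hM] := diff_bound _ _ C1.
exists (2 * (4 * M)); first by rewrite !mulr_ge0.
move=> x y; apply: le_trans (en_le_norm _) _; rewrite -mulrA ler_wpM2l //.
rewrite -!gh; apply: (sphere_lipschitz g M M0 _ _ _ _ (sv_unit x) (sv_unit y)).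
- by move=> s s1; case: C1 => _ sU dg _; apply/dg/sU.
- by move=> s v s1 _; apply: hM.
Qed.

(** The Lipschitz bound is applied to the difference of the two extensions. In [8 = 2 * 4] one
    factor passes from the sup norm to the Euclidean one, the other from chords to arcs. *)
Lemma C1close_lip h1 h2 (e : R) : 0 < e -> C1close h1 h2 e -> forall x y,
  en ((sv (h2 x) - sv (h2 y)) - (sv (h1 x) - sv (h1 y))) <= 8 * e * en (sv x - sv y).
Proof.
move=> e0 [U [g1 [g2 [[C1 gh1] [C2 gh2] hc]]]] x y.
have -> : (sv (h2 x) - sv (h2 y)) - (sv (h1 x) - sv (h1 y)) = (g2 - g1) (sv x) - (g2 - g1) (sv y).
  rewrite -!gh1 -!gh2 -![(_ - _ : V R -> V R) _]/(_ - _).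
  by rewrite !opprD !opprK addrACA.
apply: le_trans (en_le_norm _) _.
have -> : 8 * e = 2 * (4 * e) :> R by ring.
rewrite -mulrA ler_wpM2l //.
have sd g s : C1ext U g -> dotp s s = 1 -> differentiable g s.
  by move=> [_ sU dg _] s1; apply/dg/sU.
apply: (sphere_lipschitz _ e (ltW e0) _ _ _ _ (sv_unit x) (sv_unit y)).
- by move=> s s1; apply: differentiableB; apply: sd.
- move=> s v s1 tv v1; rewrite diffB; [|exact: sd|exact: sd].
  have [_ /(_ v tv v1) /=] := hc (exist _ s s1).
  have dd (a b : V R) : `|a - b| < e -> `|b - a| <= e by rewrite distrC => /ltW.
  exact: dd.
Qed.

(** The second clause is C1 smallness read on chords: it bounds the relative error of each factor of
    a cross ratio, however close the points are. *)
Definition near_id (e : R) h := (forall x, en (sv (h x) - sv x) <= e) /\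
  forall x y, en ((sv (h x) - sv (h y)) - (sv x - sv y)) <= e * en (sv x - sv y).

(** The inverse is required to be as close to the identity, so that words can be inverted letter by
    letter. *)
Definition small h := exists k, [/\ cancel h k, cancel k h, near_id (1/10) h & near_id (1/10) k].

(** On chords, passing to the inverse replaces [e] by [e / (1 - e)], here [1/19]. *)
Lemma near_id_small h k : cancel h k -> cancel k h -> near_id (1/20) h -> small h.
Proof.
move=> hk kh [h1 h2]; exists k; split => //.
- split=> [x|x y]; first by apply: le_trans (h1 x) _; lra.
  by apply: le_trans (h2 x y) _; rewrite ler_wpM2r ?en_ge0 //; lra.
- split=> [x|x y].
    by have := h1 (k x); rewrite kh en_sub; lra.
  have := h2 (k x) (k y); rewrite !kh.
  have := enD ((sv (k x) - sv (k y)) - (sv x - sv y)) (sv x - sv y).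
  rewrite subrK [en ((sv x - _) - _)]en_sub; have := en_ge0 (sv x - sv y); lra.
Qed.

Lemma small_inj h : small h -> injective h.
Proof. by move=> [k [hk _ _ _]]; exact: can_inj hk. Qed.

Lemma small_lip h : small h -> lip_le 2 h.
Proof.
move=> [k [_ _ [_ h2] _]] x y; have := h2 x y.
have := enD ((sv (h x) - sv (h y)) - (sv x - sv y)) (sv x - sv y).
by rewrite subrK; have := en_ge0 (sv x - sv y); lra.
Qed.

Fixpoint compose (w : seq (S2 R -> S2 R)) : S2 R -> S2 R :=
  if w is h :: w' then h \o compose w' else id.

Lemma compose_cat w1 w2 : compose (w1 ++ w2) = compose w1 \o compose w2.
Proof. by elim: w1 => //= h w1 ->. Qed.

Fixpoint all_small (w : seq (S2 R -> S2 R)) : Prop :=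
  if w is h :: w' then small h /\ all_small w' else True.

Lemma all_small_cat w1 w2 : all_small w1 -> all_small w2 -> all_small (w1 ++ w2).
Proof. by elim: w1 => //= h w1 IH [? /IH h1] /h1. Qed.

Lemma compose_small_inj w : all_small w -> injective (compose w).
Proof.
elim: w => [_ x y //|h w IH /= [sh /IH iw]].
by apply: inj_comp => //; exact: small_inj.
Qed.

Lemma compose_small_lip w : all_small w -> lip_le (2 ^+ size w) (compose w).
Proof.
elim: w => [_ x y /=|h w IH /= [/small_lip sh /IH iw] x y /=]; first by rewrite expr0 mul1r.
apply: le_trans (sh _ _) _; rewrite exprS -mulrA ler_wpM2l //.
Qed.

Lemma compose_small_inv w : all_small w -> exists w', [/\ all_small w', size w' = size w,
  cancel (compose w) (compose w') & cancel (compose w') (compose w)].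
Proof.
elim: w => [_|h w IH /= [[k [hk kh sh sk]] /IH[w' [aw' sw' c1 c2]]]].
  by exists [::].
exists (w' ++ [:: k]); split.
- by apply: all_small_cat => //=; split => //; exists h.
- by rewrite size_cat sw' addn1.
- by rewrite compose_cat => x /=; rewrite hk.
- by rewrite compose_cat => x /=; rewrite c2.
Qed.

Definition generated h := exists w, all_small w /\ compose w = h.

Lemma C1close_quotient h : is_diff1 h -> exists2 e : R, 0 < e &
  forall h', is_diff1 h' -> C1close h h' e -> exists q, small q /\ h' = q \o h.
Proof.
move=> [hi [hhi hih _ /C1map_lip[M M0 lM]]].
have M1 : 0 < M + 1 by lra.
have e0 : 0 < 1 / (160 * (M + 1)) by rewrite divr_gt0 // mulr_gt0.
(* Chosen so that [8 * e * M <= 1/20], the tolerance of [near_id_small], where [M] is a Lipschitz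
   constant of the inverse of [h]; [M + 1] avoids a zero denominator. *)
exists (1 / (160 * (M + 1))) => //.
move=> h' [h'i [hh'i h'ih _ _]]; set e := _ / _ in e0 *; move=> cl.
have eM : e * (M + 1) = 1 / 160.
  by rewrite /e; field; rewrite gt_eqF.
exists (h' \o hi); split; last by apply/funext => x /=; rewrite hhi.
apply: (near_id_small _ (h \o h'i)).
- by move=> x /=; rewrite hh'i hih.
- by move=> x /=; rewrite hhi h'ih.
split=> [x|x y] /=.
  have [U [g1 [g2 [_ _ /(_ (hi x))[hc _]]]]] := cl.
  rewrite hih in hc; rewrite en_sub; apply: le_trans (en_le_norm _) _.
  by nra.
have := C1close_lip _ _ _ e0 cl (hi x) (hi y); rewrite !hih => hl.
apply: le_trans hl _; have := lM x y.
by have := en_ge0 (sv x - sv y); have := en_ge0 (sv (hi x) - sv (hi y)); nra.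
Qed.

(** An open subgroup is also closed: the generated maps contain a neighbourhood of each of their
    members, and so does their complement, because small maps have small inverses. A connected set
    containing [id] cannot meet both. *)
Lemma Diff10_generated h : Diff10 h -> generated h.
Proof.
move=> [_ [C [[CD Ccon] Cid Ch]]].
have [] := Ccon generated (~` generated).
- move=> k kd [w [aw cw]]; have [e e0 he] := C1close_quotient k kd.
  exists e => // k' k'd /(he _ k'd)[q [sq ->]].
  by exists (q :: w); split => //=; rewrite cw.
- move=> k kd nk; have [e e0 he] := C1close_quotient k kd.
  exists e => // k' k'd /(he _ k'd)[q [sq k'E]] [w [aw cw]]; apply: nk.
  have [p [qp pq sp sqq]] := sq.
  exists (p :: w); split; first by split => //; exists q.
  by rewrite /= cw k'E; apply/funext => x /=; rewrite qp.
- by move=> k _; apply: lem.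
- by apply/seteqP; split => // k [[_ ?] ?].
- by move=> /seteqP[/(_ id)] + _; case; split => //; exists [::].
- move=> /seteqP[hn _]; have [//|ng] := lem (generated h).
  by have := hn h; case.
Qed.

End Generation.

(** * Turning of the cross ratio *)

Section CrossRatio.
Context {R : realType}.
Implicit Types (u v a b c d : V R).

(** This is [(a - b) (b - d)^-1 (d - c) (c - a)^-1] up to a positive real factor: the inverse of a
    pure quaternion is a negative multiple of it, and two factors are inverted. *)
Definition crossq (a b c d : V R) : quat :=
  qmul (qmul (vq (a - b)) (vq (b - d))) (qmul (vq (d - c)) (vq (c - a))).

Definition qvdot (q : @quat R) u := qi q * u ord0 k0 + qj q * u ord0 k1 + qk q * u ord0 k2.

Definition crossX a b c d := qr (crossq a b c d).
(** For unit vectors the quaternion is [crossX + crossY a], by [crossq_decomp]: these are its real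
    and imaginary parts in the complex line of [a]. *)
Definition crossY a b c d := qvdot (crossq a b c d) a.

(** Since [a^2 = b^2 = -1], both sides equal [-1 - a b]. Moving a unit vector across a chord thus
    exchanges the endpoints and changes the sign. *)
Lemma chord_anticomm a b : dotp a a = 1 -> dotp b b = 1 ->
  qmul (vq a) (vq (a - b)) = qopp (qmul (vq (a - b)) (vq b)).
Proof.
rewrite !dotpE => a1 b1; rewrite /(@qopp R) /(@qmul R) /= !mxE.
by congr Quat; lra.
Qed.

Lemma chord2_comm a b d : dotp a a = 1 -> dotp b b = 1 -> dotp d d = 1 ->
  qmul (vq a) (qmul (vq (a - b)) (vq (b - d))) = qmul (qmul (vq (a - b)) (vq (b - d))) (vq d).
Proof.
move=> a1 b1 d1; rewrite qmulA chord_anticomm //.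
have -> : forall x y z : @quat R, qmul (qopp (qmul x y)) z = qopp (qmul x (qmul y z)).
  by move=> x y z; rewrite qmulA /(@qopp R) /(@qmul R) /=; congr Quat; ring.
by rewrite chord_anticomm // /(@qopp R) /(@qmul R) /=; congr Quat; ring.
Qed.

(** Crossing four chords turns [a] into [b], [d], [c] and back into [a], with four sign changes. *)
Lemma crossq_comm a b c d :
  dotp a a = 1 -> dotp b b = 1 -> dotp c c = 1 -> dotp d d = 1 ->
  qmul (vq a) (crossq a b c d) = qmul (crossq a b c d) (vq a).
Proof.
move=> a1 b1 c1 d1; rewrite /crossq qmulA chord2_comm // -qmulA chord2_comm //.
by rewrite !qmulA.
Qed.

Lemma comm_unit_decomp (q : quat) a : dotp a a = 1 -> qmul (vq a) q = qmul q (vq a) ->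
  q = Quat (qr q) (qvdot q a * a ord0 k0) (qvdot q a * a ord0 k1) (qvdot q a * a ord0 k2).
Proof.
rewrite dotpE /qvdot /qmul => a1 [_ e0 e1 e2].
set x := a ord0 k0 in a1 e0 e1 e2 *; set y := a ord0 k1 in a1 e0 e1 e2 *.
set z := a ord0 k2 in a1 e0 e1 e2 *.
have h0 : y * qk q = z * qj q by lra.
have h1 : z * qi q = x * qk q by lra.
have h2 : x * qj q = y * qi q by lra.
case: q h0 h1 h2 {e0 e1 e2} => r p q s /= h0 h1 h2; congr Quat.
- have -> : (p * x + q * y + s * z) * x = p * (x * x) + y * (x * q) + z * (x * s) by ring.
  by rewrite h2 -h1 -[LHS]mulr1 -a1; ring.
- have -> : (p * x + q * y + s * z) * y = x * (y * p) + q * (y * y) + z * (y * s) by ring.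
  by rewrite -h2 h0 -[LHS]mulr1 -a1; ring.
- have -> : (p * x + q * y + s * z) * z = x * (z * p) + y * (z * q) + s * (z * z) by ring.
  by rewrite h1 -h0 -[LHS]mulr1 -a1; ring.
Qed.

Lemma crossq_decomp a b c d :
  dotp a a = 1 -> dotp b b = 1 -> dotp c c = 1 -> dotp d d = 1 ->
  crossq a b c d = Quat (crossX a b c d) (crossY a b c d * a ord0 k0)
    (crossY a b c d * a ord0 k1) (crossY a b c d * a ord0 k2).
Proof. by move=> *; apply: comm_unit_decomp => //; exact: crossq_comm. Qed.

Lemma crossq_norm a b c d : qnorm (crossq a b c d) =
  en (a - b) * en (b - d) * (en (d - c) * en (c - a)).
Proof. by rewrite /crossq !qnormM !qnorm_vq. Qed.

Lemma cross_norm a b c d :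
  dotp a a = 1 -> dotp b b = 1 -> dotp c c = 1 -> dotp d d = 1 ->
  crossX a b c d ^+ 2 + crossY a b c d ^+ 2 = qnorm (crossq a b c d) ^+ 2.
Proof.
move=> a1 b1 c1 d1; rewrite qnorm_sqr crossq_decomp // /qdot /=.
move: (crossX _ _ _ _) (crossY _ _ _ _) => X Y; move: a1; rewrite dotpE => a1.
have -> : X ^+ 2 + Y ^+ 2 = X ^+ 2 + Y ^+ 2 * (a ord0 k0 * a ord0 k0 + a ord0 k1 * a ord0 k1 + a ord0 k2 * a ord0 k2).
  by rewrite a1 mulr1.
by ring.
Qed.

End CrossRatio.

(** * Turning of a word as an additive lift of the argument *)

Section Turning.
Context {R : realType}.
Implicit Types (a b c d : S2 R) (h k : S2 R -> S2 R) (w : seq (S2 R -> S2 R)).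
Local Notation sv x := (proj1_sig x).

(** Only the four differences occurring in [crossq] must be nonzero. The case [b = c] stays allowed:
    there the turning is known to vanish. *)
Definition valid (a b c d : S2 R) := [/\ a <> b, b <> d, d <> c & c <> a].

Lemma valid_map h a b c d : injective h -> valid a b c d -> valid (h a) (h b) (h c) (h d).
Proof. by move=> ih [ab bd dc ca]; split=> /ih. Qed.

Lemma en_gt0_neq (a b : S2 R) : a <> b -> 0 < en (sv a - sv b).
Proof. by move=> ab; rewrite en_gt0 subr_eq0; apply/eqP => /sv_inj. Qed.

Lemma crossq_gt0 a b c d : valid a b c d -> 0 < qnorm (crossq (sv a) (sv b) (sv c) (sv d)).
Proof. by move=> [ab bd dc ca]; rewrite crossq_norm !mulr_gt0 // en_gt0_neq. Qed.

(** With [crossIm], the real and imaginary parts of [(X' + i Y') (X - i Y)]; the complex lines of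
    [a] and [a'] are identified by sending both vectors to [i]. *)
Definition crossRe (a b c d a' b' c' d' : V R) :=
  crossX a' b' c' d' * crossX a b c d + crossY a' b' c' d' * crossY a b c d.
Definition crossIm (a b c d a' b' c' d' : V R) :=
  crossY a' b' c' d' * crossX a b c d - crossX a' b' c' d' * crossY a b c d.

(** The four relative errors give [|Q' - Q| <= |Q| / 2], hence [qdot Q Q' >= |Q|^2 / 2]. This
    differs from [crossRe] only because the axes [a] and [h a] differ, by [Y Y' (1 - <a, h a>)],
    which is at most [2 |Q|^2 / 200]. *)
Lemma crossRe_gt0 h a b c d : small h -> valid a b c d ->
  0 < crossRe (sv a) (sv b) (sv c) (sv d) (sv (h a)) (sv (h b)) (sv (h c)) (sv (h d)).
Proof.
move=> [k [_ _ [h1 h2] _]] va.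
have N0 := crossq_gt0 _ _ _ _ va.
have nr x y : near_rel (1/10) (vq (sv x - sv y)) (vq (sv (h x) - sv (h y))).
  by rewrite /near_rel -vqB !qnorm_vq; exact: h2.
have t0 : 0 <= 1 / 10 :> R by lra.
have m1 := near_rel_mul _ _ _ _ _ _ t0 t0 (nr a b) (nr b d).
have m2 := near_rel_mul _ _ _ _ _ _ t0 t0 (nr d c) (nr c a).
have t1 : 0 <= 1 / 10 + 1 / 10 + 1 / 10 * (1 / 10) :> R by lra.
have := near_rel_mul _ _ _ _ _ _ t1 t1 m1 m2.
rewrite -/(crossq (sv a) (sv b) (sv c) (sv d)).
rewrite -/(crossq (sv (h a)) (sv (h b)) (sv (h c)) (sv (h d))).
set Q := crossq (sv a) _ _ _ in N0 *; set Q' := crossq (sv (h a)) _ _ _ => nQ.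
have nQ' := near_rel_norm _ _ _ nQ.
have dQ := qdot_le Q (qsub Q' Q).
have dE : qdot Q Q' = qnorm Q ^+ 2 + qdot Q (qsub Q' Q).
  by rewrite qnorm_sqr /qdot /(@qsub R) /(@qadd R) /(@qopp R) /=; ring.
have cE : qdot Q Q' = crossX (sv a) (sv b) (sv c) (sv d) * crossX (sv (h a)) (sv (h b)) (sv (h c)) (sv (h d)) +
   crossY (sv a) (sv b) (sv c) (sv d) * crossY (sv (h a)) (sv (h b)) (sv (h c)) (sv (h d)) * dotp (sv a) (sv (h a)).
  rewrite /Q /Q' crossq_decomp ?sv_unit // [crossq (sv (h a)) _ _ _]crossq_decomp ?sv_unit //.
  by rewrite /qdot dotpE /=; ring.
have n1 := cross_norm _ _ _ _ (sv_unit a) (sv_unit b) (sv_unit c) (sv_unit d).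
have n2 := cross_norm _ _ _ _ (sv_unit (h a)) (sv_unit (h b)) (sv_unit (h c)) (sv_unit (h d)).
rewrite -/Q in n1; rewrite -/Q' in n2.
rewrite /crossRe; move: cE n1 n2.
set X := crossX (sv a) _ _ _; set Y := crossY (sv a) _ _ _.
set X' := crossX _ _ _ _; set Y' := crossY _ _ _ _ => cE n1 n2.
have hp : 1 - dotp (sv a) (sv (h a)) = en (sv (h a) - sv a) ^+ 2 / 2.
  by rewrite en_sqr !dotpL !sv_unit (dotpC (sv (h a))); field.
have e1 := h1 a; have e0 := en_ge0 (sv (h a) - sv a).
have p0 : 0 <= 1 - dotp (sv a) (sv (h a)) <= 1 / 200 by rewrite hp; apply/andP; split; nra.
have q0 := qnorm_ge0 Q'.
have Yb : `|Y * Y'| <= qnorm Q * qnorm Q'.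
  rewrite normrM ler_pM //.
    by rewrite -(@ler_pXn2r _ 2) ?nnegrE ?qnorm_ge0 // real_normK ?num_real //; have := sqr_ge0 X; lra.
  by rewrite -(@ler_pXn2r _ 2) ?nnegrE ?qnorm_ge0 // real_normK ?num_real //; have := sqr_ge0 X'; lra.
have YB : `|Y * Y' * (1 - dotp (sv a) (sv (h a)))| <= qnorm Q * qnorm Q' * (1 / 200).
  case/andP: p0 => p0 p1; rewrite normrM (ger0_norm p0) ler_pM //.
have QQ' : qnorm Q * qnorm Q' <= qnorm Q * (2 * qnorm Q).
  rewrite ler_wpM2l ?qnorm_ge0 //; move: nQ'; lra.
have QD : qnorm Q * qnorm (qsub Q' Q) <= qnorm Q * (1/2 * qnorm Q).
  rewrite ler_wpM2l ?qnorm_ge0 //; move: nQ; rewrite /near_rel; lra.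
have -> : X' * X + Y' * Y = qdot Q Q' + Y * Y' * (1 - dotp (sv a) (sv (h a))).
  by rewrite cE; ring.
rewrite dE; have N2 : 0 < qnorm Q * qnorm Q by rewrite mulr_gt0.
have := lerNnormlW dQ; have := lerNnormlW YB; rewrite expr2; lra.
Qed.

(** For [b = c] the chords pair off as [x y (-y) (-x)], a nonnegative real number. *)
Lemma cross_degenerate (a b d : V R) :
  crossX a b b d = en (a - b) ^+ 2 * en (b - d) ^+ 2 /\ crossY a b b d = 0.
Proof.
rewrite !en_sqr !dotpE /crossX /crossY /qvdot /crossq /qmul /= !mxE; split; ring.
Qed.

Definition turn h (a b c d : S2 R) : R :=
  atan (crossIm (sv a) (sv b) (sv c) (sv d) (sv (h a)) (sv (h b)) (sv (h c)) (sv (h d)) /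
        crossRe (sv a) (sv b) (sv c) (sv d) (sv (h a)) (sv (h b)) (sv (h c)) (sv (h d))).

Definition rotates (t x y x' y' : R) := exists2 r : R, 0 < r &
  x' = r * (cos t * x - sin t * y) /\ y' = r * (sin t * x + cos t * y).

Lemma rotates0 x y : rotates 0 x y x y.
Proof. by exists 1 => //; rewrite cos0 sin0; split; ring. Qed.

Lemma rotatesD s t x y x' y' x'' y'' :
  rotates s x' y' x'' y'' -> rotates t x y x' y' -> rotates (s + t) x y x'' y''.
Proof.
move=> [r r0 [-> ->]] [r' r'0 [-> ->]]; exists (r * r'); first exact: mulr_gt0.
by rewrite cosD sinD; split; ring.
Qed.

Lemma rotates_atan x y x' y' : 0 < x' * x + y' * y ->
  rotates (atan ((y' * x - x' * y) / (x' * x + y' * y))) x y x' y'.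
Proof.
set p := x' * x + y' * y => p0; set q := y' * x - x' * y; set t := atan _.
have n0 : 0 < x * x + y * y.
  rewrite lt_neqAle addr_ge0 -?expr2 ?sqr_ge0 // andbT eq_sym.
  apply/eqP => h; move/eqP: h; rewrite paddr_eq0 ?sqr_ge0 // !sqrf_eq0 => /andP[/eqP x0 /eqP y0].
  by move: p0; rewrite /p x0 y0 !mulr0 addr0 ltxx.
have ct : 0 < cos t by apply: cos_gt0_pihalf; rewrite atan_gtNpi2 atan_ltpi2.
have tt : sin t = cos t * q / p.
  have : tan t = q / p by rewrite atanK.
  by rewrite /tan => /(canRL (divfK _)) ->; rewrite ?gt_eqF // mulrC mulrA.
exists (p / ((x * x + y * y) * cos t)); first by rewrite divr_gt0 // mulr_gt0.
rewrite tt; split; rewrite /q /p; field; rewrite ?gt_eqF //=.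
Qed.

(** This places the difference in [pi Z] only, but any discrete set is enough for the continuity
    argument to come. *)
Lemma rotates_sin s t x y x' y' : 0 < x ^+ 2 + y ^+ 2 ->
  rotates s x y x' y' -> rotates t x y x' y' -> sin (s - t) = 0.
Proof.
move=> n0 [r r0 [-> ->]] [r' r'0 [e1 e2]]; rewrite sinB.
have : r * r' * (x ^+ 2 + y ^+ 2) * (sin s * cos t - cos s * sin t) =
   (r * (sin s * x + cos s * y)) * (r' * (cos t * x - sin t * y)) -
   (r * (cos s * x - sin s * y)) * (r' * (sin t * x + cos t * y)) by ring.
rewrite -e1 -e2 [X in _ = X - _]mulrC subrr => /eqP.
by rewrite mulf_eq0 gt_eqF ?mulr_gt0 //= => /eqP.
Qed.

Fixpoint turning w (a b c d : S2 R) : R :=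
  if w is h :: w' then
    turn h (compose w' a) (compose w' b) (compose w' c) (compose w' d) + turning w' a b c d
  else 0.

Lemma turning_cat w1 w2 a b c d : turning (w1 ++ w2) a b c d =
  turning w1 (compose w2 a) (compose w2 b) (compose w2 c) (compose w2 d) + turning w2 a b c d.
Proof. by elim: w1 => [|h w1 IH] /=; rewrite ?add0r // IH compose_cat addrA. Qed.

Lemma turning_rotates w a b c d : all_small w -> valid a b c d ->
  rotates (turning w a b c d) (crossX (sv a) (sv b) (sv c) (sv d)) (crossY (sv a) (sv b) (sv c) (sv d))
    (crossX (sv (compose w a)) (sv (compose w b)) (sv (compose w c)) (sv (compose w d)))
    (crossY (sv (compose w a)) (sv (compose w b)) (sv (compose w c)) (sv (compose w d))).
Proof.
elim: w => [_ _|h w IH /= [sh aw] va]; first exact: rotates0.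
apply: rotatesD (IH aw va); apply: rotates_atan; apply: crossRe_gt0 => //.
by apply: valid_map => //; exact: compose_small_inj.
Qed.

Lemma turning_bound w a b c d : `|turning w a b c d| <= 2 * (size w)%:R.
Proof.
elim: w => [|h w IH] /=; first by rewrite normr0 mulr0.
apply: le_trans (ler_normD _ _) _; rewrite -[(size w).+1%:R]natr1 mulrDr mulr1 addrC lerD //.
rewrite ler_norml /turn; set y := _ / _; have := pihalf_lt2 R.
by have := atan_gtNpi2 y; have := atan_ltpi2 y; lra.
Qed.

Lemma turning_degenerate w a b d : turning w a b b d = 0.
Proof.
elim: w => //= h w ->; rewrite addr0 /turn /crossIm.
have [_ ->] := cross_degenerate (sv (compose w a)) (sv (compose w b)) (sv (compose w d)).
have [_ ->] := cross_degenerate (sv (h (compose w a))) (sv (h (compose w b))) (sv (h (compose w d))).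
by rewrite mul0r mulr0 subrr mul0r atan0.
Qed.

Lemma turning_sin w w' a b c d : all_small w -> all_small w' -> compose w = compose w' ->
  valid a b c d -> sin (turning w a b c d - turning w' a b c d) = 0.
Proof.
move=> aw aw' ww' va; apply: rotates_sin (turning_rotates _ _ _ _ _ aw va) _.
  by rewrite cross_norm ?sv_unit // exprn_gt0 // crossq_gt0.
by rewrite ww'; exact: turning_rotates.
Qed.

End Turning.

(** * Independence of the turning from the word *)

Section Paths.
Context {R : realType}.
Implicit Types (h k : S2 R -> S2 R) (w : seq (S2 R -> S2 R)) (A B C D : R -> S2 R).
Local Notation sv x := (proj1_sig x).

Definition path_cont A s := forall i, {for s, continuous (fun t => sv (A t) ord0 i)}.

Lemma path_cont_cst (a : S2 R) s : path_cont (fun=> a) s.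
Proof. by move=> i; exact: cvg_cst. Qed.

Lemma path_contP A s : path_cont A s <->
  forall e, 0 < e -> \forall t \near s, en (sv (A s) - sv (A t)) <= e.
Proof.
split=> [cA e e0|H i].
  have e2 : 0 < e / 2 by rewrite divr_gt0.
  near=> t; apply: le_trans (en_le_norm _) _.
  rewrite mulrC -ler_pdivlMr //; apply: norm_coord_le; first exact: ltW.
  apply: ord3P; rewrite mxE [X in _ + X]mxE.
  - by near: t; have /cvgrPdist_le := cA k0; apply.
  - by near: t; have /cvgrPdist_le := cA k1; apply.
  - by near: t; have /cvgrPdist_le := cA k2; apply.
apply/cvgrPdist_le => e e0; near=> t.
have h : en (sv (A s) - sv (A t)) <= e by near: t; exact: H.
by apply: le_trans h; apply: le_trans (coord_le_en _ i); rewrite !mxE.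
Unshelve. all: by end_near. Qed.

Lemma path_cont_lip M h A s : 0 <= M -> lip_le M h -> path_cont A s ->
  path_cont (fun t => h (A t)) s.
Proof.
move=> M0 lM /path_contP cA; apply/path_contP => e e0.
have M1 : 0 < M + 1 by lra.
near=> t; apply: le_trans (lM _ _) _.
have : en (sv (A s) - sv (A t)) <= e / (M + 1).
  by near: t; apply: cA; rewrite divr_gt0.
rewrite ler_pdivlMr // => h1; apply: le_trans h1.
by rewrite mulrC ler_wpM2l ?en_ge0 //; lra.
Unshelve. all: by end_near. Qed.

Definition qcont (q : R -> @quat R) s :=
  [/\ {for s, continuous (fun t => qr (q t))}, {for s, continuous (fun t => qi (q t))},
      {for s, continuous (fun t => qj (q t))} & {for s, continuous (fun t => qk (q t))}].

Lemma for_contD (f g : R -> R) s : {for s, continuous f} -> {for s, continuous g} ->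
  {for s, continuous (fun t => f t + g t)}.
Proof. exact: cvgD. Qed.
Lemma for_contB (f g : R -> R) s : {for s, continuous f} -> {for s, continuous g} ->
  {for s, continuous (fun t => f t - g t)}.
Proof. exact: cvgB. Qed.
Lemma for_contM (f g : R -> R) s : {for s, continuous f} -> {for s, continuous g} ->
  {for s, continuous (fun t => f t * g t)}.
Proof. exact: cvgM. Qed.

Lemma for_contV (f : R -> R) s : {for s, continuous f} -> f s != 0 ->
  {for s, continuous (fun t => (f t)^-1)}.
Proof. by move=> cf f0; apply: cvgV. Qed.
Lemma for_cont_comp (f g : R -> R) s : {for s, continuous f} -> continuous g ->
  {for s, continuous (fun t => g (f t))}.
Proof. by move=> cf cg; apply: (@continuous_comp _ _ _ f g) => //; exact: cg. Qed.

Lemma qcont_mul p q s : qcont p s -> qcont q s -> qcont (fun t => qmul (p t) (q t)) s.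
Proof.
move=> [p0 p1 p2 p3] [q0 q1 q2 q3]; split; rewrite /qmul /=;
by repeat first [assumption | apply: for_contM | apply: for_contB | apply: for_contD].
Qed.

Lemma qcont_vq A B s : path_cont A s -> path_cont B s ->
  qcont (fun t => vq (sv (A t) - sv (B t))) s.
Proof.
move=> cA cB; have h i : {for s, continuous (fun t => (sv (A t) - sv (B t)) ord0 i)}.
  under [X in {for s, continuous X}]eq_fun do rewrite mxE [X in _ + X]mxE.
  exact: for_contB.
have h0 : {for s, continuous (fun _ : R => 0 : R)} by exact: cvg_cst.
by split; [exact: h0|exact: h|exact: h|exact: h].
Qed.

Lemma crossX_cont A B C D s : path_cont A s -> path_cont B s -> path_cont C s -> path_cont D s ->
  {for s, continuous (fun t => crossX (sv (A t)) (sv (B t)) (sv (C t)) (sv (D t)))}.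
Proof.
move=> cA cB cC cD.
by have [] : qcont (fun t => crossq (sv (A t)) (sv (B t)) (sv (C t)) (sv (D t))) s
  by do 2?apply: qcont_mul; exact: qcont_vq.
Qed.

Lemma crossY_cont A B C D s : path_cont A s -> path_cont B s -> path_cont C s -> path_cont D s ->
  {for s, continuous (fun t => crossY (sv (A t)) (sv (B t)) (sv (C t)) (sv (D t)))}.
Proof.
move=> cA cB cC cD.
have [_ q1 q2 q3] : qcont (fun t => crossq (sv (A t)) (sv (B t)) (sv (C t)) (sv (D t))) s.
  by do 2?apply: qcont_mul; exact: qcont_vq.
by do 2?apply: for_contD; apply: for_contM => //; exact: cA.
Qed.

Lemma turn_cont h A B C D s : small h ->
  path_cont A s -> path_cont B s -> path_cont C s -> path_cont D s ->
  valid (A s) (B s) (C s) (D s) ->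
  {for s, continuous (fun t => turn h (A t) (B t) (C t) (D t))}.
Proof.
move=> sh cA cB cC cD va; have p := crossRe_gt0 _ _ _ _ _ sh va.
have l2 := small_lip _ sh.
have hc F : path_cont F s -> path_cont (fun t => h (F t)) s.
  by apply: path_cont_lip l2.
have X1 := crossX_cont _ _ _ _ _ cA cB cC cD.
have Y1 := crossY_cont _ _ _ _ _ cA cB cC cD.
have X2 := crossX_cont _ _ _ _ _ (hc _ cA) (hc _ cB) (hc _ cC) (hc _ cD).
have Y2 := crossY_cont _ _ _ _ _ (hc _ cA) (hc _ cB) (hc _ cC) (hc _ cD).
have cR := for_contD _ _ _ (for_contM _ _ _ X2 X1) (for_contM _ _ _ Y2 Y1).
have cI := for_contB _ _ _ (for_contM _ _ _ Y2 X1) (for_contM _ _ _ X2 Y1).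
have cV := for_contV _ _ cR (lt0r_neq0 p).
exact: for_cont_comp (for_contM _ _ _ cI cV) (@continuous_atan R).
Qed.

Lemma turning_cont w A B C D s : all_small w ->
  path_cont A s -> path_cont B s -> path_cont C s -> path_cont D s ->
  valid (A s) (B s) (C s) (D s) ->
  {for s, continuous (fun t => turning w (A t) (B t) (C t) (D t))}.
Proof.
move=> + cA cB cC cD va; elim: w => [_|h w IH /= [sh aw]]; first exact: cvg_cst.
have hc F : path_cont F s -> path_cont (fun t => compose w (F t)) s.
  by apply: path_cont_lip (compose_small_lip _ aw); rewrite exprn_ge0.
apply: for_contD (IH aw).
apply: (turn_cont h (fun t => compose w (A t)) (fun t => compose w (B t))
   (fun t => compose w (C t)) (fun t => compose w (D t))) => //; try exact: hc.
by apply: valid_map => //; exact: compose_small_inj.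
Qed.

Definition normalize (v : V R) (v0 : v != 0) : S2 R :=
  exist _ ((en v)^-1 *: v) (normalized_dotp v v0).

Lemma en_normalize (v : V R) (v0 : v != 0) : v = en v *: sv (normalize v v0).
Proof. by rewrite /= scalerA divff ?scale1r // en_eq0. Qed.

Lemma path_cont_normalize (F : R -> V R) (F0 : forall t, F t != 0) s :
  (forall i, {for s, continuous (fun t => F t ord0 i)}) ->
  path_cont (fun t => normalize (F t) (F0 t)) s.
Proof.
move=> cF i /=.
have cd : {for s, continuous (fun t => dotp (F t) (F t))}.
  under [X in {for s, continuous X}]eq_fun do rewrite dotpE.
  have sq i := for_contM _ _ _ (cF i) (cF i).
  exact: (for_contD _ _ _ (for_contD _ _ _ (sq k0) (sq k1)) (sq k2)).
have ce : {for s, continuous (fun t => en (F t))}.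
  exact: for_cont_comp cd (@sqrt_continuous R).
have e0 : en (F s) != 0 by rewrite en_eq0.
have ci := for_contV _ _ ce e0.
under [X in {for s, continuous X}]eq_fun do rewrite mxE.
exact: (for_contM _ _ _ ci (cF i)).
Qed.

(** * Curves from [c] to [b] that avoid two given points *)

Section Bypass.
Variables b c : V R.
Hypothesis (b1 : dotp b b = 1) (c1 : dotp c c = 1) (bc : crossp c b != 0).

Let n := crossp c b.
Let nu := dotp n n.

(* Curves with different [m] meet, up to positive scaling, only on the rays of
   [b] and [c], so one of [m = 0, 1, 2] avoids two given points. *)
Definition bypass (m t : R) : V R := (1 - t) *: c + t *: b + (t * (1 - t) * m) *: n.

Let nu0 : 0 < nu.
Proof. by rewrite lt_neqAle dotp_ge0 andbT eq_sym dotp_eq0. Qed.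

Let bypass1 m t : triple (bypass m t) b n = (1 - t) * nu.
Proof. rewrite /nu /n tripleE !dotpE /bypass !mxE /=; ring. Qed.

Let bypass2 m t : triple c (bypass m t) n = t * nu.
Proof. rewrite /nu /n tripleE !dotpE /bypass !mxE /=; ring. Qed.

Let bypass3 m t : dotp (bypass m t) n = t * (1 - t) * m * nu.
Proof. rewrite /nu /n !dotpE /bypass !mxE /=; ring. Qed.

Lemma bypass_neq0 m t : bypass m t != 0.
Proof.
apply/eqP => h; have := bypass1 m t; have := bypass2 m t; rewrite h.
by rewrite !tripleE !mxE => h1 h2; have := nu0; lra.
Qed.

(** The triple products with [b], [c], [n] read off [1 - t] and [t] up to the scale [r]. As these
    add up to [1], they determine [r], then [t]; the component along [n] then gives [m], unless [t]
    is [0] or [1], where the curve is at [c] or [b]. *)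
Lemma bypass_inj (a : V R) (m m' t t' r r' : R) : dotp a a = 1 -> a <> b -> a <> c ->
  0 < r -> 0 < r' -> bypass m t = r *: a -> bypass m' t' = r' *: a -> m = m'.
Proof.
move=> a1 ab ac r0 r'0 e e'.
have tl (k : R) x y z : triple (k *: x) y z = k * triple x y z.
  by rewrite !tripleE !mxE; ring.
have tm (k : R) x y z : triple x (k *: y) z = k * triple x y z.
  by rewrite !tripleE !mxE; ring.
have := bypass1 m t; have := bypass2 m t; have := bypass3 m t.
have := bypass1 m' t'; have := bypass2 m' t'; have := bypass3 m' t'.
rewrite e e' !tl !tm !dotpZl.
move: (triple a b n) (triple c a n) (dotp a n) => p q s h3' h2' h1' h3 h2 h1.
have pq : r * (p + q) = nu by lra.
have pq' : r' * (p + q) = nu by lra.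
have pq0 : p + q != 0.
  by apply/eqP => z; move: pq; rewrite z mulr0 => z'; have := nu0; rewrite -z' ltxx.
have rr : r = r' by apply: (mulIf pq0); rewrite pq pq'.
subst r'.
have tt : t = t'.
  by apply: (mulIf (lt0r_neq0 nu0)); rewrite -h2 -h2'.
subst t'.
have unit_eq (k : R) x y : 0 < k -> dotp x x = 1 -> dotp y y = 1 -> x = k *: y -> y = x.
  move=> k0 x1 y1 xy; suff k1 : k = 1 by rewrite xy k1 scale1r.
  by move: x1; rewrite xy !dotpL y1 mulr1; nra.
have [t0|t0] := eqVneq t 0.
  case: ac; apply: (unit_eq r) => //; rewrite -e /bypass t0.
  by rewrite subr0 scale1r scale0r !mul0r scale0r !addr0.
have [t1|t1] := eqVneq t 1.
  case: ab; apply: (unit_eq r) => //; rewrite -e /bypass t1.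
  by rewrite subrr scale1r scale0r mulr0 mul0r scale0r add0r addr0.
have z : t * (1 - t) * nu != 0.
  by rewrite !mulf_neq0 ?(lt0r_neq0 nu0) // subr_eq0 eq_sym.
apply: (mulIf z); move: h3 h3'; lra.
Qed.

End Bypass.

Lemma exists_path (a b c d : S2 R) : crossp (sv c) (sv b) != 0 ->
  a <> b -> a <> c -> d <> b -> d <> c -> exists C,
  [/\ forall s, path_cont C s, C 0 = c, C 1 = b & forall t, C t <> a /\ C t <> d].
Proof.
have n02 : (0 : R) <> 2 by move=> h; lra.
have n12 : (1 : R) <> 2 by move=> h; lra.
move=> bc ab ac db dc.
pose C m t := normalize (bypass (sv b) (sv c) m t) (bypass_neq0 _ _ bc m t).
have uniqm (x : S2 R) m m' t t' : x <> b -> x <> c -> C m t = x -> C m' t' = x -> m = m'.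
  move=> xb xc e e'.
  have g p q : 0 < en (bypass (sv b) (sv c) p q) by rewrite en_gt0 bypass_neq0.
  apply: (bypass_inj _ _ (sv_unit b) (sv_unit c) bc (sv x) m m' t t' _ _ (sv_unit x) _ _ (g m t) (g m' t')).
  - by move=> h; apply: xb; exact: sv_inj.
  - by move=> h; apply: xc; exact: sv_inj.
  - by rewrite -e /C -en_normalize.
  - by rewrite -e' /C -en_normalize.
have [m hm] : exists m, forall t, C m t <> a /\ C m t <> d.
  apply: contrapT => /forallNP H.
  have H' m : (exists t, C m t = a) \/ (exists t, C m t = d).
    have /existsNP[t /not_andP[/contrapT h|/contrapT h]] := H m; [left|right]; by exists t.
  have n01 : (0 : R) <> 1 by move=> /eqP; rewrite eq_sym oner_eq0.
  (* Pigeonhole: two of the three curves would pass through the same one of the two points. *)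
  have [[t0 h0]|[t0 h0]] := H' 0; have [[t1 h1]|[t1 h1]] := H' 1; have [[t2 h2]|[t2 h2]] := H' 2;
   (try by apply: n01; exact: (uniqm _ _ _ _ _ ab ac h0 h1));
   (try by apply: n02; exact: (uniqm _ _ _ _ _ ab ac h0 h2));
   (try by apply: n12; exact: (uniqm _ _ _ _ _ ab ac h1 h2));
   (try by apply: n01; exact: (uniqm _ _ _ _ _ db dc h0 h1));
   (try by apply: n02; exact: (uniqm _ _ _ _ _ db dc h0 h2));
   (by apply: n12; exact: (uniqm _ _ _ _ _ db dc h1 h2)).
have e1 (x : S2 R) : (en (sv x))^-1 = 1 by rewrite unit_sqr ?sv_unit // invr1.
exists (C m); split => //.
- move=> s; apply: path_cont_normalize => i.
  have -> : (fun t => bypass (sv b) (sv c) m t ord0 i) = fun t => (1 - t) * sv c ord0 i +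
      t * sv b ord0 i + t * (1 - t) * m * crossp (sv c) (sv b) ord0 i.
    by apply/funext => t; rewrite /bypass !mxE.
  have ct : {for s, continuous (fun t : R => t)} by exact: cvg_id.
  have cc (k : R) : {for s, continuous (fun _ : R => k)} by exact: cvg_cst.
  have c1 := for_contB _ _ _ (cc 1) ct.
  have cb := for_contM _ _ _ (for_contM _ _ _ (for_contM _ _ _ ct c1) (cc m)) (cc _).
  exact: (for_contD _ _ _ (for_contD _ _ _ (for_contM _ _ _ c1 (cc _)) (for_contM _ _ _ ct (cc _))) (cb _)).
- apply: sv_inj; rewrite /C /= /bypass.
  by rewrite subr0 scale1r scale0r !mul0r scale0r !addr0 e1 scale1r.
- apply: sv_inj; rewrite /C /= /bypass.
  by rewrite subrr scale1r scale0r mulr0 mul0r scale0r add0r addr0 e1 scale1r.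
Qed.

(** If [D 0] were nonzero, [D] would take a nonzero value in [[-1, 1]], where the sine does not
    vanish. *)
Lemma sin_eq0_const (D : R -> R) : {within `[0, 1], continuous D} ->
  (forall t, t \in `[0, 1]%R -> sin (D t) = 0) -> D 1 = 0 -> D 0 = 0.
Proof.
move=> cD sD D1; have [//|D0] := eqVneq (D 0) 0.
have ivt v : Num.min (D 0) (D 1) <= v <= Num.max (D 0) (D 1) -> sin v = 0.
  by move=> /(IVT ler01 cD)[c c01 <-]; exact: sD.
have pi2 := pi_ge2 R.
have [Dp|Dn] := ltP 0 (D 0).
  have [y [y0 y1 yD]] : exists y, [/\ 0 < y, y <= 1 & y <= D 0].
    by have [h|h] := leP (D 0) 1; [exists (D 0)|exists 1]; split => //; exact: ltW.
  have := ivt y; rewrite D1 ge_min le_max yD (ltW y0) orbT => /(_ isT) s0.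
  by suff : 0 < sin y; [rewrite s0 ltxx|apply: sin_gt0_pi; lra].
have [y [y0 y1 yD]] : exists y, [/\ 0 < y, y <= 1 & D 0 <= - y].
  have {D0}Dn : D 0 < 0 by rewrite lt_neqAle D0.
  by have [h|h] := leP (- D 0) 1; [exists (- D 0)|exists 1]; split => //; lra.
have := ivt (- y); rewrite D1 ge_min le_max yD oppr_le0 (ltW y0) orbT => /(_ isT).
rewrite sinN => s0.
by suff : 0 < sin y; [rewrite -[sin y]opprK s0 oppr0 ltxx|apply: sin_gt0_pi; lra].
Qed.

(* Sliding [c] to [b] makes the cross ratio positive, where every word has turning 0. *)
Lemma turning_unique w w' (a b c d : S2 R) : all_small w -> all_small w' ->
  compose w = compose w' -> crossp (sv c) (sv b) != 0 -> valid a b c d ->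
  turning w a b c d = turning w' a b c d.
Proof.
move=> aw aw' ww' bc va; have [ab bd dc ca] := va.
have [||C [cC C0 C1 Cad]] := exists_path a b c d bc ab _ _ dc.
- by move=> h; apply: ca.
- by move=> h; apply: bd.
(* The path may meet [b], as it does at [t = 1], because [valid] does not separate [b] from [c]. *)
have vt t : valid a b (C t) d.
  by have [h1 h2] := Cad t; split => // h; apply: h2.
apply/eqP; rewrite -subr_eq0; apply/eqP.
pose D t := turning w a b (C t) d - turning w' a b (C t) d.
have <- : D 0 = turning w a b c d - turning w' a b c d by rewrite /D C0.
apply: sin_eq0_const.
- apply: continuous_subspaceT => s.
  by apply: for_contB; apply: (turning_cont _ (fun=> a) (fun=> b) C (fun=> d)) => //;
    exact: path_cont_cst.
- by move=> t _; apply: turning_sin.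
- by rewrite /D C1 !turning_degenerate subrr.
Qed.

End Paths.

(** * Distortion elements and real eigenvalues *)

Section Distortion.
Context {R : realType}.
Implicit Types (h k f : S2 R -> S2 R) (w : seq (S2 R -> S2 R)) (S : set (S2 R -> S2 R)).
Local Notation sv x := (proj1_sig x).

Definition small_word_le (K : nat) h := exists w, [/\ all_small w, compose w = h & (size w <= K)%N].

Lemma small_word_le_mono (K K' : nat) h : (K <= K')%N -> small_word_le K h -> small_word_le K' h.
Proof. by move=> KK [w [aw cw sw]]; exists w; split => //; exact: leq_trans KK. Qed.

Lemma small_word_le_comp (K K' : nat) h k :
  small_word_le K h -> small_word_le K' k -> small_word_le (K + K') (h \o k).
Proof.
move=> [w [aw cw sw]] [w' [aw' cw' sw']]; exists (w ++ w'); split.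
- exact: all_small_cat.
- by rewrite compose_cat cw cw'.
- by rewrite size_cat leq_add.
Qed.

Lemma finite_small_words S : finite_set S -> S `<=` @Diff10 R -> exists K : nat,
  forall l, letter S l -> small_word_le K l.
Proof.
move=> fS SD.
have [K HK] : exists K : nat, forall s, S s -> small_word_le K s.
  have {SD} : forall s, S s -> exists K, small_word_le K s.
    by move=> s /SD /Diff10_generated[w [aw cw]]; exists (size w), w.
  have [r ->] := (@finite_seqP {classic (S2 R -> S2 R)} S).1 fS; elim: r => [_|s r IH H].
    by exists 0%N => s; rewrite /= in_nil.
  have [K1 h1] : exists K, small_word_le K s by apply: H; rewrite /= mem_head.
  have [K2 h2] : exists K, forall s', s' \in r -> small_word_le K s'.
    by apply: IH => s' h'; apply: H; rewrite /= in_cons; apply/orP; right.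
  exists (maxn K1 K2) => s'; rewrite /= in_cons => /orP[/eqP ->|/h2].
    exact: small_word_le_mono (leq_maxl _ _) h1.
  exact: small_word_le_mono (leq_maxr _ _).
exists K => l [/HK//|[s [/HK[w [aw cw sw]] sl ls]]].
have [w' [aw' sw' c1 c2]] := compose_small_inv _ aw.
exists w'; split; rewrite ?sw' //; apply/funext => x.
by rewrite -[in RHS](c2 x) cw sl.
Qed.

Lemma wordlen_small (K n : nat) S h : (forall l, letter S l -> small_word_le K l) ->
  wordlen_le S h n -> small_word_le (K * n) h.
Proof.
move=> HK [w [sw lw <-]]; apply: (@small_word_le_mono (K * size w)); first by rewrite leq_mul2l sw orbT.
elim: w lw {sw} => [_|l w IH lw] /=; first by exists [::].
rewrite mulnS; apply: small_word_le_comp; first by apply: HK; exact: (lw 0%N).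
by apply: IH => i iw; exact: (lw i.+1).
Qed.

Lemma distortion_words f : distortion f -> forall e : R, 0 < e -> exists N, forall n, (N <= n)%N ->
  exists w, [/\ all_small w, compose w = iter n f & (size w)%:R <= e * n%:R].
Proof.
move=> [_ _ [S [fS SD _ H]]] e e0.
have [K HK] := finite_small_words S fS SD.
have K1 : 0 < K.+1%:R :> R by [].
have [N HN] := H (e / K.+1%:R) (divr_gt0 e0 K1).
exists N => n /HN[k [/(wordlen_small _ _ _ _ HK)[w [aw cw sw]] kn]].
exists w; split => //; apply: (@le_trans _ _ ((K.+1 * k)%:R)).
  by rewrite ler_nat (leq_trans sw) // leq_mul2r leqnSn orbT.
rewrite natrM; apply: le_trans (ler_wpM2l (ltW K1) kn) _.
by rewrite mulrA mulrCA mulfV ?mulr1 // lt0r_neq0.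
Qed.

Lemma continuous_en : continuous (@en R).
Proof.
move=> u; have cd := continuous_dotp id id u (@cvg_id _ _) (@cvg_id _ _).
exact: (@continuous_comp _ _ _ (fun v : V R => dotp v v) (@Num.sqrt R) u cd (@sqrt_continuous R _)).
Qed.

Lemma is_derive_en_le (c d : R -> V R) (c' d' : V R) (M : R) :
  is_derive 0 (1 : R) c c' -> is_derive 0 (1 : R) d d' ->
  (forall t, en (c t - c 0) <= M * en (d t - d 0)) -> en c' <= M * en d'.
Proof.
have lim (k : R -> V R) (k' : V R) : is_derive 0 (1 : R) k k' ->
    en (h^-1 *: (k h - k 0)) @[h --> 0^'] --> en k'.
  move=> [k1 k2]; apply: continuous_cvg; first exact: continuous_en.
  move: k1; rewrite /derivable /derive => k1; rewrite /derive in k2.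
  move/cvg_ex: (k1) => [l kl].
  have kk : k' = l by rewrite -k2; apply/cvg_lim.
  rewrite kk; apply: cvg_trans kl; apply: near_eq_cvg; near=> h.
  by rewrite /= addr0 [h *: (1 : R)]mulr1.
move=> /lim hc /lim hd H.
apply: (ler_cvg_to hc (cvgM (cvg_cst M) hd)).
near=> h; rewrite /= !enZ; have := ler_wpM2l (normr_ge0 h^-1) (H h).
by rewrite mulrCA.
Unshelve. all: by end_near. Qed.

(** If [x > 1], Bernoulli's inequality gives some [m] with [x ^ m > 2]. With [e = 1 / m] the
    exponent satisfies [k * m <= n], so [(x ^ m) ^ n <= 2 ^ n], a contradiction. *)
Lemma exp_growth_le1 (x : R) : 0 <= x ->
  (forall e : R, 0 < e -> exists N, forall n, (N <= n)%N -> exists k : nat,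
     k%:R <= e * n%:R /\ x ^+ n <= 2 ^+ k) -> x <= 1.
Proof.
move=> x0 H; rewrite leNgt; apply/negP => x1.
have [m m2] : exists m : nat, 2 < x ^+ m.
  have y0 : 0 < x - 1 by lra.
  pose m := (Num.truncn (2 / (x - 1))).+1; exists m.
  have hm : 2 / (x - 1) < m%:R by exact: truncnS_gt.
  have B (p : nat) : 1 + p%:R * (x - 1) <= x ^+ p.
    elim: p => [|p IH]; first by rewrite mul0r addr0 expr0.
    rewrite exprS -[p.+1%:R]natr1; have p0 : 0 <= p%:R :> R by [].
    by have := ler_wpM2l x0 IH; have := mulr_ge0 p0 (sqr_ge0 (x - 1)); rewrite expr2; lra.
  apply: lt_le_trans (B m); move: hm; rewrite ltr_pdivrMr // => hm; lra.
have m0 : (0 < m)%N by case: m m2 => // ; rewrite expr0 => h; exfalso; lra.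
have m0' : 0 < m%:R :> R by rewrite ltr0n.
have [|N HN] := H (1 / m%:R); first by rewrite divr_gt0.
have [k [k1 k2]] := HN N.+1 (leqnSn N).
have km : (k * m <= N.+1)%N.
  by move: k1; rewrite mulrC mulrA ler_pdivlMr // mulr1 -natrM ler_nat.
have : (x ^+ N.+1) ^+ m <= (2 ^+ k) ^+ m :> R by rewrite ler_pXn2r ?nnegrE ?exprn_ge0.
rewrite -!exprM mulnC exprM => h.
have : (x ^+ m) ^+ N.+1 <= 2 ^+ N.+1.
  by apply: le_trans h _; rewrite ler_weXn2l //; lra.
rewrite ler_pXn2r ?nnegrE ?exprn_ge0 //; lra.
Qed.

Definition arcS2 (z e : V R) (z1 : dotp z z = 1) (e1 : dotp e e = 1) (ze : dotp z e = 0) (t : R) : S2 R :=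
  exist _ (gcarc z e t) (arc_unit z e t z1 e1 ze).

(** Along the arc leaving [z] in direction [e], the map [f ^ n] has derivative [mu ^ n *: e], and
    chord estimates for [f ^ n] pass to this derivative. *)
Lemma distortion_real_eigenvalue f (z : S2 R) U g (e : V R) (mu : R) :
  distortion f -> f z = z -> extends f U g -> dotp e e = 1 -> tangent (sv z) e ->
  'd g (sv z) e = mu *: e -> `|mu| = 1.
Proof.
move=> df fz [[oU sU dg cg] gf] e1 ze Ae.
pose P := arcS2 (sv z) e (sv_unit z) e1 ze.
have P0 : P 0 = z by apply: sv_inj; rewrite /= arc0.
have fzn n : iter n f z = z by elim: n => //= n ->.
have dP : is_derive 0 (1 : R) (fun t => sv (P t)) e.
  have := is_derive_arc (sv z) e 0.
  by rewrite /dgcarc sin0 cos0 oppr0 scale0r scale1r add0r.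
have dn n : is_derive 0 (1 : R) (fun t => sv (iter n f (P t))) (mu ^+ n *: e).
  elim: n => [|n IH]; first by rewrite expr0 scale1r.
  have c0 : sv (iter n f (P 0)) = sv z by rewrite P0 fzn.
  have := is_derive_diff_comp _ _ g 0 _ IH; rewrite c0 => /(_ (dg _ (sU _ (sv_unit z)))).
  rewrite linearZ /= Ae scalerA -exprSr.
  by congr (is_derive _ _ _ _); apply/funext => t /=; rewrite gf.
have en1 : en e = 1 by rewrite unit_sqr.
have bd n w : all_small w -> compose w = iter n f ->
    `|mu| ^+ n <= 2 ^+ size w /\ 1 <= 2 ^+ size w * `|mu| ^+ n.
  move=> aw cw; split.
  - have := is_derive_en_le _ _ _ _ (2 ^+ size w) (dn n) dP _.
    rewrite enZ en1 !mulr1 normrX; apply => t.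
    by rewrite -cw; exact: compose_small_lip.
  (* The inverse word has the same length, so its Lipschitz constant bounds [|mu| ^ n] from
     below. *)
  - have [w' [aw' sw' c1 c2]] := compose_small_inv _ aw.
    have := is_derive_en_le _ _ _ _ (2 ^+ size w) dP (dn n) _.
    rewrite enZ en1 !mulr1 normrX; apply => t.
    have := compose_small_lip _ aw' (iter n f (P t)) (iter n f (P 0)).
    by rewrite -cw !c1 sw'.
apply/eqP; rewrite eq_le; apply/andP; split.
  apply: exp_growth_le1 => // ep ep0; have [N HN] := distortion_words _ df _ ep0.
  exists N => n /HN[w [aw cw sw]]; exists (size w); split => //.
  by have [] := bd n w aw cw.
have mu0 : `|mu| != 0.
  apply/eqP => h; have [N HN] := distortion_words _ df _ ltr01.
  have [w [aw cw sw]] := HN N.+1 (leqnSn N); have [_] := bd _ _ aw cw.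
  by rewrite h expr0n mulr0 ler10.
have mup : 0 < `|mu| by rewrite lt_neqAle eq_sym mu0 normr_ge0.
suff : `|mu|^-1 <= 1 by rewrite invf_le1.
apply: exp_growth_le1; first by rewrite invr_ge0.
move=> ep ep0; have [N HN] := distortion_words _ df _ ep0.
exists N => n /HN[w [aw cw sw]]; exists (size w); split => //.
by have [_] := bd n w aw cw; rewrite exprVn -ler_pdivrMr ?exprn_gt0 // mul1r.
Qed.

End Distortion.

(** * Orientation *)

Section Orientation.
Context {R : realType}.
Implicit Types (h k f : S2 R -> S2 R) (u v : V R) (z : S2 R).
Local Notation sv x := (proj1_sig x).

Lemma extends_diff h U g z : extends h U g -> differentiable g (sv z).
Proof. by move=> [[_ sU dg _] _]; apply/dg/sU; exact: sv_unit. Qed.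

Lemma is_derive_extends h U g z u (u1 : dotp u u = 1) (zu : dotp (sv z) u = 0) : extends h U g ->
  is_derive 0 (1 : R) (fun t => sv (h (arcS2 (sv z) u (sv_unit z) u1 zu t))) ('d g (sv z) u).
Proof.
move=> eg; have dP := is_derive_arc (sv z) u 0.
have a0 := arc0 (sv z) u.
have := is_derive_diff_comp _ _ g 0 _ dP; rewrite a0 => /(_ (extends_diff _ _ _ _ eg)).
rewrite /dgcarc sin0 cos0 oppr0 scale0r scale1r add0r.
by congr (is_derive _ _ _ _); apply/funext => t /=; rewrite -eg.2.
Qed.

Lemma arcS20 z u (u1 : dotp u u = 1) (zu : dotp (sv z) u = 0) :
  arcS2 (sv z) u (sv_unit z) u1 zu 0 = z.
Proof. by apply: sv_inj; rewrite /= arc0. Qed.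

(** Along an arc in the sphere any extension coincides with [h], so both sides are the derivative of
    the same curve. *)
Lemma tangent_diff_unique h U g U' g' z u : dotp u u = 1 -> tangent (sv z) u ->
  extends h U g -> extends h U' g' -> 'd g (sv z) u = 'd g' (sv z) u.
Proof.
move=> u1 zu eg eg'.
have [_ e1] := is_derive_extends h U g z u u1 zu eg.
have [_ e2] := is_derive_extends h U' g' z u u1 zu eg'.
exact: etrans (esym e1) e2.
Qed.

Lemma tangent_diff h U g z u : dotp u u = 1 -> tangent (sv z) u -> extends h U g ->
  tangent (sv (h z)) ('d g (sv z) u).
Proof.
move=> u1 zu eg; have := is_derive_extends h U g z u u1 zu eg; set c := fun t => _ => dc.
have c0 : c 0 = sv (h z) by rewrite /c arcS20.
pose F i : R -> R := fun t => c t ord0 i.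
have dF i : is_derive 0 (1 : R) (F i) ('d g (sv z) u ord0 i) by exact: is_derive_coord.
have dd := is_deriveD (is_deriveD (is_deriveM (dF k0) (dF k0)) (is_deriveM (dF k1) (dF k1)))
   (is_deriveM (dF k2) (dF k2)).
have E : F k0 * F k0 + F k1 * F k1 + F k2 * F k2 = cst (1 : R).
  by apply/funext => t; rewrite /cst -(sv_unit (h (arcS2 (sv z) u (sv_unit z) u1 zu t))) dotpE.
rewrite E in dd; have := @derive_val _ _ _ _ _ _ _ dd.
rewrite derive_cst /tangent dotpE -c0 /F /= /GRing.scale /=.
by lra.
Qed.

Lemma diff_neq0 h U g z u : is_diff1 h -> dotp u u = 1 -> tangent (sv z) u ->
  extends h U g -> 'd g (sv z) u <> 0.
Proof.
move=> [k [hk kh _ [U' [g' eg']]]] u1 zu eg w0.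
have dc := is_derive_extends _ _ _ _ _ u1 zu eg; rewrite w0 in dc.
have := is_derive_diff_comp _ _ g' 0 _ dc.
rewrite arcS20 linear0 => /(_ (extends_diff _ _ _ _ eg'))[_ d0].
have [_ d1] := is_derive_arc (sv z) u 0.
have E : g' \o (fun t => sv (h (arcS2 (sv z) u (sv_unit z) u1 zu t))) = gcarc (sv z) u.
  by apply/funext => t /=; rewrite eg'.2 hk.
rewrite E in d0; move: d1; rewrite d0 /dgcarc sin0 cos0 oppr0 scale0r scale1r add0r => u0.
by have := u1; rewrite -{1 2}u0 dotpE !mxE !mulr0 !addr0 => /eqP; rewrite eq_sym oner_eq0.
Qed.

Lemma en_crossp u v : en (crossp u v) <= en u * en v.
Proof.
rewrite -(@ler_pXn2r _ 2) ?nnegrE ?mulr_ge0 ?en_ge0 // exprMn !en_sqr.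
have -> : dotp (crossp u v) (crossp u v) = dotp u u * dotp v v - dotp u v ^+ 2.
  by rewrite !dotpE !mxE /=; ring.
by have := sqr_ge0 (dotp u v); lra.
Qed.

Lemma triple_le u v (w : V R) : `|triple u v w| <= en u * (en v * en w).
Proof.
apply: le_trans (dotp_le _ _) _; rewrite ler_wpM2l ?en_ge0 //; exact: en_crossp.
Qed.

Lemma triple_perturb u v w (u' v' w' : V R) (e : R) : 0 <= e <= 1 ->
  en (u' - u) <= e -> en (v' - v) <= e -> en (w' - w) <= e ->
  `|triple u' v' w' - triple u v w| <=
  e * ((en v + 1) * (en w + 1) + en u * (en w + 1) + en u * en v).
Proof.
move=> /andP[e0 e1] hu hv hw.
have -> : triple u' v' w' - triple u v w =
   triple (u' - u) v' w' + triple u (v' - v) w' + triple u v (w' - w).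
  by rewrite !tripleE !mxE; ring.
have bv : en v' <= en v + 1 by have := enD (v' - v) v; rewrite subrK; lra.
have bw : en w' <= en w + 1 by have := enD (w' - w) w; rewrite subrK; lra.
have p x := en_ge0 (x : V R).
apply: le_trans (ler_normD _ _) _; rewrite mulrDr lerD //; last first.
  apply: le_trans (triple_le _ _ _) _; rewrite [leRHS]mulrC -mulrA ler_wpM2l //.
  by rewrite ler_wpM2l.
apply: le_trans (ler_normD _ _) _; rewrite mulrDr lerD //.
  apply: le_trans (triple_le _ _ _) _; rewrite ler_pM ?mulr_ge0 //.
  by rewrite ler_pM.
apply: le_trans (triple_le _ _ _) _; rewrite [leRHS]mulrCA ler_wpM2l //.
by rewrite ler_pM.
Qed.

Lemma triple_stable u v w : triple u v w != 0 -> exists2 e : R, 0 < e &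
  forall u' v' w' : V R, `|u - u'| < e -> `|v - v'| < e -> `|w - w'| < e ->
  `|triple u' v' w' - triple u v w| < `|triple u v w|.
Proof.
move=> j0; have jp : 0 < `|triple u v w| by rewrite normr_gt0.
pose K := (en v + 1) * (en w + 1) + en u * (en w + 1) + en u * en v.
have K0 : 0 <= K.
  by rewrite /K; do !apply: addr_ge0; rewrite ?mulr_ge0 ?addr_ge0 ?en_ge0.
pose e := Num.min (1 / 2) (`|triple u v w| / (4 * (K + 1))).
have K1 : 0 < K + 1 by lra.
have e0 : 0 < e by rewrite /e lt_min !divr_gt0 ?mulr_gt0.
have eh : e <= 1 / 2 by rewrite /e ge_min lexx.
have eK : e * (4 * (K + 1)) <= `|triple u v w|.
  by rewrite -ler_pdivlMr ?mulr_gt0 // /e ge_min lexx orbT.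
have sm (x y : V R) : `|x - y| < e -> en (y - x) <= 2 * e.
  by move=> xy; rewrite en_sub; apply: le_trans (en_le_norm _) _; rewrite ler_wpM2l // ltW.
have e2b : 0 <= 2 * e <= 1 by apply/andP; split; lra.
exists e => // u' v' w' /sm hu /sm hv /sm hw.
apply: le_lt_trans (triple_perturb _ _ _ _ _ _ _ e2b hu hv hw) _.
rewrite -/K; lra.
Qed.

(** * Sign of the Jacobian determinant *)

Section Jacobian.
Variables (z : S2 R) (e1 e2 : V R).
Hypotheses (e11 : dotp e1 e1 = 1) (e22 : dotp e2 e2 = 1) (e12 : dotp e1 e2 = 0).
Hypotheses (ze1 : tangent (sv z) e1) (ze2 : tangent (sv z) e2).

(** The Jacobian determinant up to the orientation of [e1], [e2]: the point [h z] serves as normal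
    vector at the image, so no frame has to be chosen there. *)
Definition jac h (g : V R -> V R) := triple (sv (h z)) ('d g (sv z) e1) ('d g (sv z) e2).

Lemma jac_neq0 h U g : is_diff1 h -> extends h U g -> jac h g != 0.
Proof.
move=> dh eg; apply/eqP => j0.
have t1 := tangent_diff _ _ _ _ _ e11 ze1 eg.
have t2 := tangent_diff _ _ _ _ _ e22 ze2 eg.
have := crossp_tangent _ _ _ (sv_unit (h z)) t1 t2; rewrite -/(jac h g) j0 scale0r.
have n2 := diff_neq0 _ _ _ _ _ dh e22 ze2 eg.
have key (al be : R) : al *: 'd g (sv z) e1 + be *: 'd g (sv z) e2 = 0 -> al = 0.
  move=> hab; apply/eqP/negPn/negP => al0.
  have n0 : al *: e1 + be *: e2 != 0.
    apply/eqP => hh; have : dotp (al *: e1 + be *: e2) e1 = 0.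
      by rewrite hh dotpE !mxE !mul0r !addr0.
    by rewrite !dotpL e11 (dotpC e2) e12 mulr0 addr0 mulr1; exact/eqP.
  pose u := (en (al *: e1 + be *: e2))^-1 *: (al *: e1 + be *: e2).
  apply: (diff_neq0 h U g z u dh _ _ eg).
  - exact: normalized_dotp.
  - by rewrite /tangent /u !dotpL ze1 ze2 !mulr0 addr0 mulr0.
  - by rewrite /u linearZ linearD !linearZ /= hab scaler0.
move: key n2; set a := 'd g (sv z) e1; set b := 'd g (sv z) e2 => key n2 /rowP cr.
apply: n2; apply/eqP; rewrite -dotp_eq0; apply/eqP.
(* The combination [|b|^2 a - <a, b> b] is the double cross product of [b] with [a x b], which
   vanishes; [key] then forces [|b|^2 = 0]. *)
apply: (key _ (- dotp a b)).
have := cr k0; have := cr k1; have := cr k2; rewrite !mxE /= => c2 c1 c0.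
apply: vec3P; rewrite !mxE !dotpE.
- have -> : (b ord0 k0 * b ord0 k0 + b ord0 k1 * b ord0 k1 + b ord0 k2 * b ord0 k2) * a ord0 k0 +
     - (a ord0 k0 * b ord0 k0 + a ord0 k1 * b ord0 k1 + a ord0 k2 * b ord0 k2) * b ord0 k0 =
     (a ord0 k0 * b ord0 k1 - a ord0 k1 * b ord0 k0) * b ord0 k1
     - (a ord0 k2 * b ord0 k0 - a ord0 k0 * b ord0 k2) * b ord0 k2 by ring.
  by rewrite c1 c2; ring.
- have -> : (b ord0 k0 * b ord0 k0 + b ord0 k1 * b ord0 k1 + b ord0 k2 * b ord0 k2) * a ord0 k1 +
     - (a ord0 k0 * b ord0 k0 + a ord0 k1 * b ord0 k1 + a ord0 k2 * b ord0 k2) * b ord0 k1 =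
     (a ord0 k1 * b ord0 k2 - a ord0 k2 * b ord0 k1) * b ord0 k2
     - (a ord0 k0 * b ord0 k1 - a ord0 k1 * b ord0 k0) * b ord0 k0 by ring.
  by rewrite c0 c2; ring.
- have -> : (b ord0 k0 * b ord0 k0 + b ord0 k1 * b ord0 k1 + b ord0 k2 * b ord0 k2) * a ord0 k2 +
     - (a ord0 k0 * b ord0 k0 + a ord0 k1 * b ord0 k1 + a ord0 k2 * b ord0 k2) * b ord0 k2 =
     (a ord0 k2 * b ord0 k0 - a ord0 k0 * b ord0 k2) * b ord0 k0
     - (a ord0 k1 * b ord0 k2 - a ord0 k2 * b ord0 k1) * b ord0 k1 by ring.
  by rewrite c0 c1; ring.
Qed.

Lemma jac_unique h U g U' g' : extends h U g -> extends h U' g' -> jac h g = jac h g'.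
Proof.
move=> eg eg'; have E1 := tangent_diff_unique h U g U' g' z e1 e11 ze1 eg eg'.
have E2 := tangent_diff_unique h U g U' g' z e2 e22 ze2 eg eg'.
exact: f_equal2 E1 E2.
Qed.

Lemma jac_stable h U g : extends h U g -> jac h g != 0 -> exists2 e : R, 0 < e &
  forall h', C1close h h' e -> exists U' g', extends h' U' g' /\ `|jac h' g' - jac h g| < `|jac h g|.
Proof.
move=> eg j0; have [e e0 he] := triple_stable _ _ _ j0.
exists e => // h' [U1 [g1 [g2 [eg1 eg2 hc]]]]; exists U1, g2; split => //.
have [c0 cv] := hc z.
have n1 : `|e1| <= 1 by apply: le_trans (norm_le_en _) _; rewrite unit_sqr.
have n2 : `|e2| <= 1 by apply: le_trans (norm_le_en _) _; rewrite unit_sqr.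
have E1 := tangent_diff_unique h U g U1 g1 z e1 e11 ze1 eg eg1.
have E2 := tangent_diff_unique h U g U1 g1 z e2 e22 ze2 eg eg1.
have cv1 := eq_ind_r (fun x => `|x - 'd g2 (sv z) e1| < e) (cv _ ze1 n1) E1.
have cv2 := eq_ind_r (fun x => `|x - 'd g2 (sv z) e2| < e) (cv _ ze2 n2) E2.
exact: he c0 cv1 cv2.
Qed.

(** The Jacobian never vanishes and its sign is stable under C1-small changes, so the two signs cut
    a connected set into two open parts, and [id] lies in the positive one. *)
Lemma Diff10_jac_gt0 f U g : 0 < triple (sv z) e1 e2 -> Diff10 f -> extends f U g -> 0 < jac f g.
Proof.
move=> tp [df [C [[CD Ccon] Cid Cf]]] eg.
pose A s h := exists U g, extends h U g /\ 0 < s * jac h g.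
have same_sign (s x y : R) : `|y - x| < `|x| -> 0 < s * x -> 0 < s * y.
  rewrite ltr_distl; case: (ltgtP x 0) => [jn|jp|->].
  - rewrite ltr0_norm // => /andP[_ h2].
    by rewrite !(mulrC s) !nmulr_rgt0 //; lra.
  - rewrite gtr0_norm // => /andP[h1 h2].
    by rewrite !(mulrC s) !pmulr_rgt0 //; lra.
  - by rewrite mulr0 ltxx.
have opn s : C1open (A s).
  move=> h dh [U1 [g1 [eg1 j1]]].
  have [e e0 he] := jac_stable h U1 g1 eg1 (jac_neq0 h U1 g1 dh eg1).
  exists e; first exact: e0.
  move=> h' _ hc; have [U' [g' [eg' jj]]] := he h' hc.
  exists U', g'; split; [exact: eg'|exact: same_sign jj j1].
have eid : extends id setT (@id (V R)).
  split => //; split=> [|//|x _|v x _]; [exact: openT|exact: ex_diff|].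
  have -> : (fun y : V R => 'd id y v) = cst v.
    by apply/funext => y; rewrite diff_val.
  exact: (@cst_continuous (V R) (V R) v x).
have Aid : A 1 id.
  exists setT, id; split => //; rewrite mul1r /jac.
  by rewrite !diff_val.
have dich h U1 g1 : is_diff1 h -> extends h U1 g1 -> 0 < 1 * jac h g1 \/ 0 < -1 * jac h g1.
  move=> dh eg1; have := jac_neq0 h U1 g1 dh eg1; move: (jac h g1) => x x0.
  by case: (ltgtP x 0) x0 => [xn|xp|//] _; [right|left]; lra.
have excl (x y : R) : x = y -> 0 < 1 * x -> 0 < -1 * y -> False by move=> ->; lra.
have [] := Ccon (A 1) (A (-1)) (opn 1) (opn (-1)).
- move=> h Ch; have dh := CD _ Ch; have [_ [_ _ [U1 [g1 eg1]] _]] := dh.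
  by case: (dich h U1 g1 dh eg1) => j1; [left|right]; exists U1, g1; split; [exact: eg1|exact: j1|exact: eg1|exact: j1].
- apply/seteqP; split; last by move=> h [].
  move=> h [[_ [U1 [g1 [eg1 j1]]]] [U2 [g2 [eg2 j2]]]].
  exact: excl (jac_unique h U1 g1 U2 g2 eg1 eg2) j1 j2.
- by move=> /seteqP[/(_ id) + _]; case; split; [exact: Cid|exact: Aid].
- move=> /seteqP[H _]; case: (dich f U g df eg) => [|j1]; first by rewrite mul1r.
  by case: (H f); split; [exact: Cf|exists U, g; split; [exact: eg|exact: j1]].
Qed.

End Jacobian.

End Orientation.

(** * The cross ratio near a fixed point *)

Section Expansion.
Context {R : realType}.
Implicit Types (u v : V R).
Local Notation sv x := (proj1_sig x).

Lemma qr_le (q : @quat R) : `|qr q| <= qnorm q.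
Proof.
rewrite -(@ler_pXn2r _ 2) ?nnegrE ?qnorm_ge0 // real_normK ?num_real // qnorm_sqr /qdot.
have := sqr_ge0 (qi q); have := sqr_ge0 (qj q); have := sqr_ge0 (qk q); rewrite !expr2; lra.
Qed.

Lemma qvdot_le (q : @quat R) u : en u = 1 -> `|qvdot q u| <= qnorm q.
Proof.
move=> u1; have := qdot_le (qsub q (Quat (qr q) 0 0 0)) (vq u); rewrite qnorm_vq u1 mulr1.
have -> : qdot (qsub q (Quat (qr q) 0 0 0)) (vq u) = qvdot q u.
  by rewrite /qdot /qvdot /qsub /qadd /qopp /=; ring.
move=> h; apply: le_trans h _; rewrite ler_wsqrtr // /qdot /qsub /qadd /qopp /=.
have := sqr_ge0 (qr q); rewrite !expr2; lra.
Qed.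

(* [crossq z b' b d] is the quotient of the cross ratios of [(z, b', c, d)] and [(z, b, c, d)]. *)
Lemma cross_quotient z b b' c d :
  dotp z z = 1 -> dotp b b = 1 -> dotp b' b' = 1 -> dotp c c = 1 -> dotp d d = 1 ->
  let N := (en (d - c) * en (c - z)) ^+ 2 : R in
  crossX z b' c d * crossX z b c d + crossY z b' c d * crossY z b c d = N * crossX z b' b d /\
  crossY z b' c d * crossX z b c d - crossX z b' c d * crossY z b c d = N * crossY z b' b d.
Proof.
move=> z1 b1 b'1 c1 d1 N.
pose q := qmul (crossq z b' c d) (qconj (crossq z b c d)).
have E1 : q = qscale N (crossq z b' b d).
  have conjM (x y : @quat R) : qconj (qmul x y) = qmul (qconj y) (qconj x).
    by rewrite /qconj /qmul /=; congr Quat; ring.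
  have conjv u v : qconj (vq (u - v)) = vq (v - u).
    by rewrite /qconj /vq /= !mxE; congr Quat; ring.
  have cN (x : @quat R) : qmul x (qconj x) = Quat (qnorm x ^+ 2) 0 0 0.
    by rewrite qnorm_sqr /qmul /qconj /qdot /=; congr Quat; ring.
  (* Both cross ratios end with [p = (d - c) (c - z)]. It meets its conjugate and leaves the real
     factor [N], so that [c] disappears from the quotient. *)
  rewrite /q /crossq; set p := qmul (vq (d - c)) _; rewrite conjM.
  set s := qmul (vq (z - b')) _; set t := qmul (vq (z - b)) (vq (b - d)).
  have -> : qmul (qmul s p) (qmul (qconj p) (qconj t)) = qscale N (qmul s (qconj t)).
    rewrite -qmulA (qmulA p) cN /p qnormM !qnorm_vq -/N.
    by rewrite /qmul /qscale /=; congr Quat; ring.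
  by rewrite /t conjM !conjv.
have E2 : q = Quat (crossX z b' c d * crossX z b c d + crossY z b' c d * crossY z b c d)
    ((crossY z b' c d * crossX z b c d - crossX z b' c d * crossY z b c d) * z ord0 k0)
    ((crossY z b' c d * crossX z b c d - crossX z b' c d * crossY z b c d) * z ord0 k1)
    ((crossY z b' c d * crossX z b c d - crossX z b' c d * crossY z b c d) * z ord0 k2).
  rewrite /q crossq_decomp // [crossq z b c d]crossq_decomp //.
  move: (crossX z b c d) (crossY z b c d) (crossX z b' c d) (crossY z b' c d) => X Y X' Y'.
  move: z1; rewrite dotpE => z1; rewrite /qconj /qmul /=; congr Quat; try by ring.
  have -> : X' * X + Y' * Y = X' * X + Y' * Y * (z ord0 k0 * z ord0 k0 + z ord0 k1 * z ord0 k1 + z ord0 k2 * z ord0 k2).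
    by rewrite z1 mulr1.
  by ring.
split; first by have := congr1 (@qr R) (etrans (esym E2) E1).
have qz (x Y : R) : qvdot (Quat x (Y * z ord0 k0) (Y * z ord0 k1) (Y * z ord0 k2)) z = Y.
  by rewrite /qvdot /= -[RHS]mulr1 -z1 dotpE; ring.
have := congr1 (fun x => qvdot x z) (etrans (esym E2) E1); rewrite /= qz => ->.
by rewrite /crossY /qvdot /=; ring.
Qed.

(** As [b] and [b'] tend to [z], the factor [(b' - d) (d - b)] tends to the real number [D]. What
    remains is [(z - b') (b - z)], whose real part and [z]-component are the scalar product and the
    oriented area of [b - z] and [b' - z]: the angle between these vectors seen from the axis
    [z]. *)
Lemma cross_expand z b b' d :
  dotp z z = 1 -> dotp b b = 1 -> dotp b' b' = 1 -> dotp d d = 1 ->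
  let r := en (b - z) in let r' := en (b' - z) in let D := en (z - d) ^+ 2 : R in
  `|crossX z b' b d - D * dotp (b' - z) (b - z)| <= r' * r * (2 * (r + r')) /\
  `|crossY z b' b d - D * triple z (b - z) (b' - z)| <= r' * r * (2 * (r + r')).
Proof.
move=> z1 b1 b'1 d1 r r' D.
pose q0 := qscale D (qmul (vq (z - b')) (vq (b - z))).
pose W := qsub (qmul (vq (b' - d)) (vq (d - b))) (Quat D 0 0 0).
have E : qsub (crossq z b' b d) q0 = qmul (qmul (vq (z - b')) W) (vq (b - z)).
  by rewrite /q0 /crossq /W /qsub /qadd /qopp /qscale /qmul /=; congr Quat; ring.
have en2 (x y : V R) : dotp x x = 1 -> dotp y y = 1 -> en (x - y) <= 2.
  by move=> x1 y1; apply: le_trans (enD _ _) _; rewrite enN !unit_sqr //; lra.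
have WB : qnorm W <= 2 * (r + r').
  have -> : W = qadd (qmul (vq (b' - z)) (vq (d - b))) (qmul (vq (z - d)) (vq (z - b))).
    rewrite /W /D en_sqr dotpE /qsub /qadd /qopp /qmul /= !mxE; congr Quat; ring.
  apply: le_trans (qnormD _ _) _; rewrite !qnormM !qnorm_vq -/r' (en_sub z b) -/r.
  have h1 := ler_wpM2l (en_ge0 (b' - z)) (en2 _ _ d1 b1).
  have h2 := ler_wpM2r (en_ge0 (b - z)) (en2 _ _ z1 d1).
  by move: h1 h2; rewrite -/r -/r'; lra.
have B : qnorm (qsub (crossq z b' b d) q0) <= r' * r * (2 * (r + r')).
  rewrite E !qnormM !qnorm_vq (en_sub z) -/r -/r' mulrAC ler_wpM2l //.
  by rewrite mulr_ge0 ?en_ge0.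
split.
- apply: le_trans B; apply: le_trans (qr_le _).
  rewrite /crossX dotpE /q0 /qsub /qadd /qopp /qscale /= !mxE.
  by rewrite le_eqVlt; apply/orP; left; apply/eqP; congr `|_|; ring.
- apply: le_trans B; apply: le_trans (qvdot_le _ _ (unit_sqr _ z1)).
  rewrite /crossY tripleE /q0 /qsub /qadd /qopp /qscale /qvdot /= !mxE.
  by rewrite le_eqVlt; apply/orP; left; apply/eqP; congr `|_|; ring.
Qed.

Lemma differentiable_expand (g : V R -> V R) (z : V R) (e : R) : 0 < e -> differentiable g z ->
  exists2 r : R, 0 < r & forall b, en (b - z) < r -> en (g b - g z - 'd g z (b - z)) <= e * en (b - z).
Proof.
move=> e0 /diff_locally /eqaddoP => /(_ (e / 2)) H.
have e2 : 0 < e / 2 by rewrite divr_gt0.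
have /nbhs_ballP[r /= r0 rH] := H e2.
exists r => // b br.
have /rH : ball (0 : V R) r (b - z).
  by rewrite -ball_normE /= sub0r normrN; apply: le_lt_trans (norm_le_en _) br.
rewrite /= -![(_ - _ : V R -> V R) _]/(_ - _) /=.
move=> h; apply: le_trans (en_le_norm _) _.
have n := norm_le_en (b - z).
move: h; rewrite -![(_ + _ : V R -> V R) _]/(_ + _) /= /shift /cst /= subrK opprD addrA => h.
apply: le_trans (ler_wpM2l _ h) _ => //.
by rewrite mulrA (mulrC 2) divfK // ler_wpM2l // ltW.
Qed.

End Expansion.

(** * Gap at a fixed point without nonnegative eigenvalue *)

Section Rotation.
Context {R : realType}.
Implicit Types (u v : V R).
Local Notation sv x := (proj1_sig x).

Lemma continuous_triple u (F G : V R -> V R) x :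
  {for x, continuous F} -> {for x, continuous G} ->
  {for x, continuous (fun v => triple u (F v) (G v))}.
Proof.
move=> cF cG.
have hF i : {for x, continuous (fun v => F v ord0 i)}.
  by apply: (@continuous_comp _ _ _ F (fun v : V R => v ord0 i)) => //; exact: coord_continuous.
have hG i : {for x, continuous (fun v => G v ord0 i)}.
  by apply: (@continuous_comp _ _ _ G (fun v : V R => v ord0 i)) => //; exact: coord_continuous.
have -> : (fun v => triple u (F v) (G v)) = fun v =>
  u ord0 k0 * (F v ord0 k1 * G v ord0 k2 - F v ord0 k2 * G v ord0 k1) +
  u ord0 k1 * (F v ord0 k2 * G v ord0 k0 - F v ord0 k0 * G v ord0 k2) +
  u ord0 k2 * (F v ord0 k0 * G v ord0 k1 - F v ord0 k1 * G v ord0 k0).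
  by apply/funext => v; rewrite tripleE.
have p i j : {for x, continuous (fun v => F v ord0 i * G v ord0 j)} by exact: cvgM (hF i) (hG j).
have q i j k : {for x, continuous (fun v =>
    u ord0 k * (F v ord0 i * G v ord0 j - F v ord0 j * G v ord0 i))}.
  exact: cvgM (cvg_cst (u ord0 k)) (cvgB (p i j) (p j i)).
exact: cvgD (cvgD (q k1 k2 k0) (q k2 k0 k1)) (q k0 k1 k2).
Qed.

Variables (f : S2 R -> S2 R) (z d : S2 R) (A : {linear V R -> V R}).
Hypotheses (fz : f z = z) (zd : z <> d).
Hypothesis cA : continuous A.
Hypothesis expA : forall e : R, 0 < e -> exists2 r : R, 0 < r & forall b : S2 R,
  en (sv b - sv z) < r -> en (sv (f b) - sv z - A (sv b - sv z)) <= e * en (sv b - sv z).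
Hypothesis no_pos : forall u, dotp u u = 1 -> tangent (sv z) u ->
  triple (sv z) u (A u) = 0 -> dotp u (A u) < 0.

(** [G] is nonnegative, and [G u = 0] would mean a zero triple product with [dotp u (A u) >= 0],
    which [no_pos] excludes. Its minimum on the compact unit circle of the tangent plane is
    therefore positive, and homogeneity of degree two covers the other vectors. *)
Lemma tangent_gap : exists2 dl : R, 0 < dl & forall u, tangent (sv z) u ->
  dl * dotp u u <= `|triple (sv z) u (A u)| \/ dl * dotp u u <= - dotp u (A u).
Proof.
pose T : set (V R) := [set u | dotp u u = 1] `&` [set u | dotp (sv z) u = 0].
pose G u := `|triple (sv z) u (A u)| + (`|dotp u (A u)| - dotp u (A u)).
have [w0 [w01 zw0]] := exists_orthogonal (sv z).
have T0 : T !=set0 by exists w0.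
have cid (x : V R) : {for x, continuous (@id (V R))} by exact: cvg_id.
have ccst (y x : V R) : {for x, continuous (fun=> y : V R)} by exact: cst_continuous.
have cT : compact T.
  apply: (subclosed_compact _ compact_sphere); last by move=> u [].
  apply: closedI.
    apply: (@closed_comp _ _ (fun u : V R => dotp u u) [set 1]); last exact: closed_eq.
    by move=> u _; exact: (continuous_dotp id id).
  apply: (@closed_comp _ _ (fun u : V R => dotp (sv z) u) [set 0]); last exact: closed_eq.
  by move=> u _; exact: (continuous_dotp (fun=> sv z) id).
have cG : {within T, continuous G}.
  apply: continuous_subspaceT => x.
  have c1 := continuous_triple (sv z) id A x (cid x) (@cA x).
  have c2 := continuous_dotp id A x (cid x) (@cA x).
  exact: cvgD (cvg_norm c1) (cvgB (cvg_norm c2) c2).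
have [m mT Gm] := EVT_min_rV T0 cT cG.
move: mT; rewrite inE => -[m1 zm].
have Gp : 0 < G m.
  rewrite /G; have [I0|I0] := eqVneq (triple (sv z) m (A m)) 0.
    by have := no_pos _ m1 zm I0 => h; rewrite I0 normr0 ltr0_norm //; lra.
  rewrite ltr_pwDl ?normr_gt0 //; have := ler_norm (dotp m (A m)); lra.
exists (G m / 4); first by rewrite divr_gt0.
have unitc u : dotp u u = 1 -> tangent (sv z) u ->
    G m / 4 <= `|triple (sv z) u (A u)| \/ G m / 4 <= - dotp u (A u).
  move=> u1 zu; have : G m <= G u by apply: Gm; rewrite inE.
  rewrite {2}/G => GG; have [hI|hI] := leP (G m / 4) (`|triple (sv z) u (A u)|); first by left.
  right; case: (ger0P (dotp u (A u))) GG => [h|h] GG; lra.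
move=> u zu; have [u0|u0] := eqVneq u 0.
  left; have -> : dotp u u = 0 by apply/eqP; rewrite dotp_eq0 u0.
  by rewrite mulr0.
have e0 : 0 < en u by rewrite en_gt0.
have uE : u = en u *: ((en u)^-1 *: u) by rewrite scalerA divff ?scale1r ?lt0r_neq0.
set v := (en u)^-1 *: u in uE.
have v1 : dotp v v = 1 by exact: normalized_dotp.
have zv : tangent (sv z) v by rewrite /tangent /v dotpZr zu mulr0.
have AZ (k : R) x : A (k *: x) = k *: A x by rewrite linearZ.
have tZ (k : R) x : triple (sv z) (k *: x) (A (k *: x)) = k ^+ 2 * triple (sv z) x (A x).
  by rewrite AZ !tripleE !mxE; ring.
have dZ (k : R) x : dotp (k *: x) (A (k *: x)) = k ^+ 2 * dotp x (A x).
  by rewrite AZ !dotpL; ring.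
have ee : 0 < en u ^+ 2 by rewrite exprn_gt0.
have := tZ (en u) v; have := dZ (en u) v; rewrite -uE -en_sqr => -> ->.
rewrite normrM (gtr0_norm ee) -mulrN !(mulrC _ (en u ^+ 2)) !ler_pM2l //.
exact: unitc.
Qed.

Variable wf : seq (S2 R -> S2 R).
Hypotheses (awf : all_small wf) (cwf : compose wf = f).

Let M : R := 2 ^+ size wf.
Let M1 : 1 <= M. Proof. by rewrite exprn_ege1 // ler1n. Qed.

Let lipf b : en (sv (f b) - sv z) <= M * en (sv b - sv z).
Proof. by have := compose_small_lip _ awf b z; rewrite cwf fz. Qed.

Let D : R := en (sv z - sv d) ^+ 2.

(** [crossX] and [crossY] agree with [D <bt, A bt>] and [D triple z bt (A bt)] up to [ep rho^2],
    where [bt] is the tangential part of [b - z]; by [tangent_gap] the first is at most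
    [-4 ep rho^2] or the second at least [4 ep rho^2] in absolute value. *)
Lemma quotient_gap : exists2 eta : R, 0 < eta & exists2 r : R, 0 < r & forall b : S2 R,
  b <> z -> en (sv b - sv z) < r ->
  eta * en (sv b - sv z) ^+ 2 < `|crossY (sv z) (sv (f b)) (sv b) (sv d)| \/
  crossX (sv z) (sv (f b)) (sv b) (sv d) < - (eta * en (sv b - sv z) ^+ 2).
Proof.
have M1' := M1; have [dl dl0 Hdl] := tangent_gap.
have D0 : 0 < D by rewrite exprn_gt0 // en_gt0_neq.
have D4 : D <= 4.
  have h : en (sv z - sv d) <= 2.
    by apply: le_trans (enD _ _) _; rewrite enN !unit_sqr ?sv_unit //; lra.
  by rewrite /D; have := en_ge0 (sv z - sv d); nra.
(* As [|bt|^2 >= rho^2 / 2], the gap [D * dl * |bt|^2] is at least [4 ep rho^2]. *)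
pose ep : R := D * dl / 8.
have ep0 : 0 < ep by rewrite /ep divr_gt0 // mulr_gt0.
exists ep => //.
pose e2 : R := Num.min 1 (ep / 16).
have e20 : 0 < e2 by rewrite /e2 lt_min ltr01 divr_gt0.
have e21 : e2 <= 1 by rewrite /e2 ge_min lexx.
have e2e : e2 <= ep / 16 by rewrite /e2 ge_min lexx orbT.
have [r1 r10 Hr1] := expA (e2 / 2) (divr_gt0 e20 (ltr0Sn _ 1)).
pose a := en (A (sv z)).
have a0 : 0 <= a by exact: en_ge0.
(* [K / 2] is the sum of [2 M (M + 1)] and [2 (M + 1)], the coefficients of the errors of third
   order in [rho]. *)
pose K : R := 4 * (M + 1) ^+ 2.
have K0 : 0 < K by rewrite /K mulr_gt0 // exprn_gt0 //; lra.
pose r := Num.min r1 (Num.min 1 (Num.min (e2 / (a + 1)) (ep / K))).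
have a1 : 0 < a + 1 by lra.
exists r; first by rewrite /r !lt_min; apply/and4P; split => //; apply: divr_gt0.
move=> b bz; rewrite /r !lt_min => /and4P[br1 b1 ba bK].
have [be beE] : exists x, x = sv b - sv z by exists (sv b - sv z).
have [be' be'E] : exists x, x = sv (f b) - sv z by exists (sv (f b) - sv z).
rewrite -beE in br1 b1 ba bK *.
set rho := en be in br1 b1 ba bK *.
have rho0 : 0 < rho by rewrite /rho beE; apply: en_gt0_neq.
have dbz : dotp (sv z) be = - (rho ^+ 2 / 2).
  by rewrite /rho en_sqr beE !dotpL !sv_unit (dotpC (sv b)); field.
(* A chord of length [rho] from [z] has normal component [- rho^2 / 2]; adding it back leaves the
   tangential part. *)
pose bt := be + (rho ^+ 2 / 2) *: sv z.
have zbt : tangent (sv z) bt.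
  by rewrite /tangent /bt !dotpL dbz sv_unit mulr1 addNr.
have btn : dotp bt bt = rho ^+ 2 - rho ^+ 4 / 4.
  by rewrite /bt !dotpL -en_sqr -/rho sv_unit (dotpC be) dbz; field.
have btle : en bt <= rho.
  rewrite -(@ler_pXn2r _ 2) ?nnegrE ?en_ge0 // en_sqr btn.
  by have := exprn_ge0 4 (ltW rho0); lra.
have btge : rho ^+ 2 / 2 <= dotp bt bt.
  rewrite btn; have -> : rho ^+ 4 = rho ^+ 2 * rho ^+ 2 by rewrite -exprD.
  have : rho ^+ 2 <= 1 by rewrite exprn_ile1 // ltW.
  by have := sqr_ge0 rho; nra.
have Eb : en (be' - A bt) <= e2 * rho.
  have h1 := Hr1 b; rewrite -beE -be'E -/rho in h1; have {}h1 := h1 br1.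
  have -> : be' - A bt = (be' - A be) - (rho ^+ 2 / 2) *: A (sv z).
    by rewrite /bt linearD linearZ opprD addrA.
  apply: le_trans (enD _ _) _; rewrite enN enZ -/a ger0_norm ?divr_ge0 ?sqr_ge0 //.
  have h2 : rho * (a + 1) <= e2 by rewrite -ler_pdivlMr // ltW.
  have h3 := ler_wpM2l (ltW rho0) h2; rewrite expr2; nra.
have r'le : en be' <= M * rho by rewrite be'E /rho beE; exact: lipf.
have [XE YE] := cross_expand _ _ _ _ (sv_unit z) (sv_unit b) (sv_unit (f b)) (sv_unit d).
rewrite -beE -be'E -/rho -/D in XE YE.
have r'0 : 0 <= en be' by exact: en_ge0.
have bK' : rho * K <= ep by rewrite -ler_pdivlMr // ltW.
have cub : en be' * rho * (2 * (rho + en be')) <= 2 * M * (M + 1) * rho * rho ^+ 2.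
  have h1 : en be' * rho <= M * rho * rho by rewrite ler_wpM2r // ltW.
  have h2 : 2 * (rho + en be') <= 2 * ((M + 1) * rho) by lra.
  have := ler_pM (mulr_ge0 r'0 (ltW rho0)) (mulr_ge0 (ler0n _ 2) (addr_ge0 (ltW rho0) r'0)) h1 h2.
  by move=> h; apply: le_trans h _; rewrite expr2 le_eqVlt; apply/orP; left; apply/eqP; ring.
have Abt : en (A bt) <= (M + 1) * rho.
  have := enD be' (A bt - be'); rewrite addrC subrK (en_sub (A bt)); nra.
have dX : `|dotp be' be - dotp bt (A bt)| <= (e2 + (M + 1) * rho / 2) * rho ^+ 2.
  have -> : dotp be' be - dotp bt (A bt) =
      dotp (be' - A bt) be - rho ^+ 2 / 2 * dotp (A bt) (sv z).
    by rewrite /bt !dotpE !mxE; field.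
  apply: le_trans (ler_normB _ _) _.
  have h1 := dotp_le (be' - A bt) be; have h2 := dotp_le (A bt) (sv z).
  rewrite -/rho in h1; rewrite (unit_sqr _ (sv_unit z)) mulr1 in h2.
  rewrite normrM ger0_norm ?divr_ge0 ?sqr_ge0 //.
  have h3 := ler_wpM2r (ltW rho0) Eb.
  have h4 := ler_wpM2l (divr_ge0 (sqr_ge0 rho) (ler0n _ 2)) (le_trans h2 Abt).
  by move: h1 h3 h4; rewrite !expr2; lra.
have dY : `|triple (sv z) be be' - triple (sv z) bt (A bt)| <= e2 * rho ^+ 2.
  have -> : triple (sv z) be be' - triple (sv z) bt (A bt) = triple (sv z) bt (be' - A bt).
    by rewrite /bt !tripleE !mxE; ring.
  apply: le_trans (triple_le _ _ _) _; rewrite (unit_sqr _ (sv_unit z)) mul1r.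
  have := ler_pM (en_ge0 _) (en_ge0 _) btle Eb; rewrite expr2; lra.
have rr0 : 0 < rho ^+ 2 by rewrite exprn_gt0.
have De : D * e2 <= ep / 4 by nra.
have Xf : `|crossX (sv z) (sv (f b)) (sv b) (sv d) - D * dotp bt (A bt)| <= ep * rho ^+ 2.
  have -> : crossX (sv z) (sv (f b)) (sv b) (sv d) - D * dotp bt (A bt) =
     (crossX (sv z) (sv (f b)) (sv b) (sv d) - D * dotp be' be) + D * (dotp be' be - dotp bt (A bt)) by ring.
  apply: le_trans (ler_normD _ _) _; rewrite normrM (gtr0_norm D0).
  have h1 := le_trans XE cub; have h2 := ler_wpM2l (ltW D0) dX.
  apply: le_trans (lerD h1 h2) _; rewrite [D * (_ * _)]mulrA -mulrDl ler_wpM2r ?(ltW rr0) //.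
  have h3 : D * ((M + 1) * rho / 2) <= 4 * ((M + 1) * rho / 2).
    by rewrite ler_wpM2r // divr_ge0 // mulr_ge0 ?(ltW rho0) //; lra.
  have h4 : 2 * M * (M + 1) * rho + 2 * (M + 1) * rho <= rho * K / 2.
    by rewrite /K le_eqVlt; apply/orP; left; apply/eqP; field.
  by lra.
have Yf : `|crossY (sv z) (sv (f b)) (sv b) (sv d) - D * triple (sv z) bt (A bt)| <= ep * rho ^+ 2.
  have -> : crossY (sv z) (sv (f b)) (sv b) (sv d) - D * triple (sv z) bt (A bt) =
     (crossY (sv z) (sv (f b)) (sv b) (sv d) - D * triple (sv z) be be') +
     D * (triple (sv z) be be' - triple (sv z) bt (A bt)) by ring.
  apply: le_trans (ler_normD _ _) _; rewrite normrM (gtr0_norm D0).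
  have h1 := le_trans YE cub; have h2 := ler_wpM2l (ltW D0) dY.
  apply: le_trans (lerD h1 h2) _; rewrite [D * (_ * _)]mulrA -mulrDl ler_wpM2r ?(ltW rr0) //.
  have h4 : 2 * M * (M + 1) * rho + 2 * (M + 1) * rho <= rho * K / 2.
    by rewrite /K le_eqVlt; apply/orP; left; apply/eqP; field.
  have h5 : 0 <= 2 * (M + 1) * rho by rewrite mulr_ge0 ?(ltW rho0) //; lra.
  by lra.
have key : 4 * ep * rho ^+ 2 <= D * (dl * dotp bt bt).
  have := ler_wpM2l (ltW D0) (ler_wpM2l (ltW dl0) btge); rewrite /ep; lra.
have epr : 0 < ep * rho ^+ 2 by rewrite mulr_gt0.
have [h|h] := Hdl bt zbt; [left|right].
- have h1 := ler_wpM2l (ltW D0) h.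
  rewrite -[X in X * `|_|](gtr0_norm D0) -normrM in h1.
  have := ler_normD (crossY (sv z) (sv (f b)) (sv b) (sv d))
    (D * triple (sv z) bt (A bt) - crossY (sv z) (sv (f b)) (sv b) (sv d)).
  by rewrite addrC subrK distrC; lra.
- have h1 := ler_wpM2l (ltW D0) h.
  by have := ler_normlW Xf; lra.
Qed.

End Rotation.

(** * Rotation at the fixed point *)

Section TurningGap.
Context {R : realType}.
Local Notation sv x := (proj1_sig x).

Lemma abs_sin_le (x : R) : `|sin x| <= `|x|.
Proof.
wlog x0 : x / 0 <= x => [H|].
  by have [/H//|x0] := leP 0 x; rewrite -normrN -sinN -[`|x|]normrN H // oppr_ge0 ltW.
have [c _] := @MVT_segment R sin cos 0 x x0 (fun y _ => is_derive_sin y)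
  (continuous_subspaceT (@continuous_sin R)).
by rewrite sin0 !subr0 => ->; rewrite normrM ler_piMl // cos_max.
Qed.

Lemma en_arc_le (z w : V R) (t : R) : dotp z z = 1 -> dotp w w = 1 -> dotp z w = 0 ->
  0 <= t -> en (gcarc z w t - z) <= 2 * t.
Proof.
move=> z1 w1 zw t0; rewrite -(@ler_pXn2r _ 2) ?nnegrE ?mulr_ge0 ?en_ge0 //.
have -> : en (gcarc z w t - z) ^+ 2 = 2 - 2 * cos t.
  rewrite en_sqr /gcarc !dotpL z1 w1 zw (dotpC w z) zw.
  by have := cos2Dsin2 t; rewrite !expr2; lra.
have := cos_mulr2n (t / 2); have -> : t / 2 *+ 2 = t by rewrite -mulr_natr divfK.
move=> ->; rewrite cos2sin2.
have : sin (t / 2) ^+ 2 <= (t / 2) ^+ 2.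
  by rewrite -[leLHS]real_normK ?num_real // -[leRHS]real_normK ?num_real // ler_pXn2r ?nnegrE // abs_sin_le.
by rewrite !expr2; have := mulr_ge0 t0 t0; lra.
Qed.

Lemma exists_angle (x y : R) : x ^+ 2 + y ^+ 2 = 1 -> exists t, cos t = x /\ sin t = y.
Proof.
move=> xy; have x1 : -1 <= x <= 1 by apply/andP; split; nra.
have c : cos (acos x) = x by apply: acosK; rewrite in_itv.
have s : sin (acos x) = `|y|.
  by rewrite sin_acos // -sqrtr_sqr; congr Num.sqrt; lra.
have [y0|y0] := leP 0 y.
  by exists (acos x); rewrite c s ger0_norm.
by exists (- acos x); rewrite cosN sinN c s ltr0_norm // opprK.
Qed.

(** In polar coordinates around [z], radius and direction are interpolated together; the radius
    stays positive, so [z] is avoided. Arc lengths are at most [4 r] and chords at most twice that;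
    [r <= 1/8] keeps the sine of the radius positive. *)
Lemma cap_path (z b0 b1 : S2 R) (r : R) : r <= 1 / 8 -> b0 <> z -> b1 <> z ->
  en (sv b0 - sv z) < r -> en (sv b1 - sv z) < r -> exists P : R -> S2 R,
  [/\ forall s, path_cont P s, P 0 = b0, P 1 = b1 &
    forall s, s \in `[0, 1]%R -> P s <> z /\ en (sv (P s) - sv z) <= 8 * r].
Proof.
move=> r8 b0z b1z b0r b1r.
have [w0 [T0 [w01 zw0 T00 E0 B0]]] := exists_arc _ _ (sv_unit z) (sv_unit b0).
have [w1 [T1 [w11 zw1 T10 E1 B1]]] := exists_arc _ _ (sv_unit z) (sv_unit b1).
have pos (b : S2 R) w T : b <> z -> 0 <= T -> gcarc (sv z) w T = sv b -> 0 < T.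
  move=> bz T_0 E; rewrite lt_neqAle T_0 andbT; apply/eqP => T0'.
  by apply: bz; apply: sv_inj; rewrite -E -T0' arc0.
have T0p := pos _ _ _ b0z T00 E0; have T1p := pos _ _ _ b1z T10 E1.
pose v := crossp (sv z) w0.
have v1 : dotp v v = 1.
  have -> : dotp v v = dotp (sv z) (sv z) * dotp w0 w0 - dotp (sv z) w0 ^+ 2.
    by rewrite /v !dotpE !mxE /=; ring.
  by rewrite sv_unit w01 zw0; ring.
have zv : dotp (sv z) v = 0 by rewrite /v !dotpE !mxE /=; ring.
have w0v : dotp w0 v = 0 by rewrite /v !dotpE !mxE /=; ring.
have xy : dotp w1 w0 ^+ 2 + dotp w1 v ^+ 2 = 1.
  have -> : dotp w1 v ^+ 2 = dotp w1 w1 * dotp (sv z) (sv z) * dotp w0 w0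
     + dotp (sv z) w1 * dotp (sv z) w0 * dotp w1 w0 *+ 2
     - dotp w1 w1 * dotp (sv z) w0 ^+ 2 - dotp w0 w0 * dotp (sv z) w1 ^+ 2
     - dotp (sv z) (sv z) * dotp w1 w0 ^+ 2.
    by rewrite /v !dotpE !mxE /=; ring.
  by rewrite w11 sv_unit w01 zw0 zw1; ring.
(* [tau] is the angle from [w0] to [w1] in the orthonormal basis [w0], [v] of the tangent plane. *)
have [tau [ct st]] := exists_angle _ _ xy.
have wE : gcarc w0 v tau = w1.
  apply/eqP; rewrite -subr_eq0 -dotp_eq0; apply/eqP.
  rewrite /gcarc !dotpL w01 v1 w11 (dotpC v w0) w0v (dotpC v w1) (dotpC w0 w1) ct st.
  by move: xy; lra.
have arcdot w t : dotp (sv z) w = 0 -> dotp w w = 1 -> dotp (gcarc (sv z) w t) w = sin t.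
  by move=> h1 h2; rewrite /gcarc !dotpL h1 h2; ring.
have wu s := arc_unit w0 v (s * tau) w01 v1 w0v.
have zw s : dotp (sv z) (gcarc w0 v (s * tau)) = 0.
  by rewrite !dotpL zw0 zv !mulr0 addr0.
pose T s := T0 + s * (T1 - T0).
pose P s := arcS2 (sv z) (gcarc w0 v (s * tau)) (sv_unit z) (wu s) (zw s) (T s).
exists P; split.
- move=> s i /=.
  have -> : (fun t => gcarc (sv z) (gcarc w0 v (t * tau)) (T t) ord0 i) = fun t =>
     cos (T t) * sv z ord0 i + sin (T t) * (cos (t * tau) * w0 ord0 i + sin (t * tau) * v ord0 i).
    by apply/funext => t; rewrite /gcarc !mxE.
  have cid : {for s, continuous (fun t : R => t)} by exact: cvg_id.
  have cc (k : R) : {for s, continuous (fun _ : R => k)} by exact: cvg_cst.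
  have cT := for_contD _ _ _ (cc T0) (for_contM _ _ _ cid (cc (T1 - T0))).
  have cta := for_contM _ _ _ cid (cc tau).
  have ccos (F : R -> R) (cF : {for s, continuous F}) := for_cont_comp _ _ _ cF (@continuous_cos R).
  have csin (F : R -> R) (cF : {for s, continuous F}) := for_cont_comp _ _ _ cF (@continuous_sin R).
  exact: (for_contD _ _ _ (for_contM _ _ _ (ccos _ cT) (cc _)) (for_contM _ _ _ (csin _ cT)
    (for_contD _ _ _ (for_contM _ _ _ (ccos _ cta) (cc _)) (for_contM _ _ _ (csin _ cta) (cc _))))).
- by apply: sv_inj; rewrite /= /T !mul0r addr0 arc0.
- by apply: sv_inj; rewrite /= /T !mul1r wE addrC subrK.
- move=> s; rewrite in_itv /= => /andP[s0 s1].
  have Tp : 0 < T s by rewrite /T; nra.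
  rewrite (en_sub (sv z)) in B0; rewrite (en_sub (sv z)) in B1.
  have Tr : T s <= 4 * r.
    have t0 : 0 <= 4 * r - T0 by lra.
    have t1 : 0 <= 4 * r - T1 by lra.
    have s1' : 0 <= 1 - s by lra.
    by have := mulr_ge0 s1' t0; have := mulr_ge0 s0 t1; rewrite /T; lra.
  split.
    move=> h; have := congr1 (fun x : S2 R => dotp (sv x) (gcarc w0 v (s * tau))) h.
    rewrite /= zw (arcdot _ _ (zw s) (wu s)) => sT.
    by have : 0 < sin (T s); [apply: sin2_gt0; lra|rewrite sT ltxx].
  have := en_arc_le _ _ (T s) (sv_unit z) (wu s) (zw s) (ltW Tp); rewrite /=; lra.
Qed.

Variables (f : S2 R -> S2 R) (z c d : S2 R).
Hypotheses (fz : f z = z) (fc : f c = c) (fd : f d = d).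
Hypotheses (zc : z <> c) (zd : z <> d) (cd : c <> d).
Variable wf : seq (S2 R -> S2 R).
Hypotheses (awf : all_small wf) (cwf : compose wf = f).
Hypothesis quotient_gap : exists2 eta : R, 0 < eta & exists2 r : R, 0 < r & forall b : S2 R,
  b <> z -> en (sv b - sv z) < r ->
  eta * en (sv b - sv z) ^+ 2 < `|crossY (sv z) (sv (f b)) (sv b) (sv d)| \/
  crossX (sv z) (sv (f b)) (sv b) (sv d) < - (eta * en (sv b - sv z) ^+ 2).

Let M : R := 2 ^+ size wf.
Let M1 : 1 <= M. Proof. by rewrite exprn_ege1 // ler1n. Qed.

Let lipf b : en (sv (f b) - sv z) <= M * en (sv b - sv z).
Proof. by have := compose_small_lip _ awf b z; rewrite cwf fz. Qed.

Let finj : injective f.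
Proof. by rewrite -cwf; exact: compose_small_inj. Qed.

Let cap_valid b : b <> z -> en (sv b - sv z) < en (sv d - sv z) -> valid z b c d.
Proof.
move=> bz bd; split => //.
- by move=> h; apply: bz.
- by move=> h; move: bd; rewrite h ltxx.
- by move=> h; apply: cd.
- by move=> h; apply: zc.
Qed.

(** If the turning [L] were small, [crossX] and [crossY] of [(z, f b, b, d)] would be [h cos L] and
    [h sin L] with [h] at most [4 M |b - z|^2]: the first is nonnegative and the second at most
    [eta |b - z|^2] in absolute value, against [quotient_gap]. *)
Lemma turning_gap : exists2 ka : R, 0 < ka & exists2 r : R, 0 < r & forall b : S2 R,
  b <> z -> en (sv b - sv z) < r -> valid z b c d /\ ka < `|turning wf z b c d|.
Proof.
have M1' := M1; have [eta eta0 [r0 r00 H]] := quotient_gap.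
have M0 : 0 < 4 * M by lra.
exists (Num.min 1 (eta / (4 * M))); first by rewrite lt_min ltr01 divr_gt0.
exists (Num.min r0 (en (sv d - sv z))).
  by rewrite lt_min r00 en_gt0_neq // => h; apply: zd.
move=> b bz; rewrite lt_min => /andP[br bd].
have va := cap_valid _ bz bd; split => //.
rewrite ltNge le_min; apply/negP => /andP[L1 L2].
have [r rp [rX rY]] := turning_rotates _ _ _ _ _ awf va.
move: L1 L2 rX rY; rewrite cwf fz fc fd; set L := turning _ _ _ _ _ => L1 L2 rX rY.
have [qX qY] := cross_quotient _ _ _ _ _ (sv_unit z) (sv_unit b) (sv_unit (f b)) (sv_unit c) (sv_unit d).
have n0 : 0 < crossX (sv z) (sv b) (sv c) (sv d) ^+ 2 + crossY (sv z) (sv b) (sv c) (sv d) ^+ 2.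
  by rewrite cross_norm ?sv_unit // exprn_gt0 // crossq_gt0.
have N0 : 0 < (en (sv d - sv c) * en (sv c - sv z)) ^+ 2.
  by rewrite exprn_gt0 // mulr_gt0 ?en_gt0_neq // => h; [apply: cd|apply: zc].
have nq := cross_norm _ _ _ _ (sv_unit z) (sv_unit (f b)) (sv_unit b) (sv_unit d).
have nqE := crossq_norm (sv z) (sv (f b)) (sv b) (sv d).
have Hb := H b bz br.
have fb := lipf b.
have en2 (x y : S2 R) : en (sv x - sv y) <= 2.
  by apply: le_trans (enD _ _) _; rewrite enN !unit_sqr ?sv_unit //; lra.
have qB : qnorm (crossq (sv z) (sv (f b)) (sv b) (sv d)) <= 4 * M * en (sv b - sv z) ^+ 2.
  rewrite nqE (en_sub (sv z)); set rho := en (sv b - sv z).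
  have h1 : en (sv (f b) - sv z) * en (sv (f b) - sv d) <= M * rho * 2 by rewrite ler_pM ?en_ge0.
  have h2 : en (sv d - sv b) * rho <= 2 * rho by rewrite ler_wpM2r ?en_ge0.
  have := ler_pM (mulr_ge0 (en_ge0 _) (en_ge0 _)) (mulr_ge0 (en_ge0 _) (en_ge0 _)) h1 h2.
  move=> h; apply: le_trans h _.
  by rewrite le_eqVlt; apply/orP; left; apply/eqP; ring.
have q0 := qnorm_ge0 (crossq (sv z) (sv (f b)) (sv b) (sv d)).
have rho0 : 0 <= en (sv b - sv z) ^+ 2 by rewrite exprn_ge0 // en_ge0.
have sL : `|sin L| <= eta / (4 * M) by apply: le_trans (abs_sin_le _) L2.
have cL : 0 <= cos L.
  by apply: cos_ge0_pihalf; have := pihalf_ge1 R; move: L1; rewrite ler_norml; lra.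
have cs := cos2Dsin2 L.
have {}sL : `|sin L| * (4 * M) <= eta by rewrite -ler_pdivlMr.
move: (4 * M) M0 sL qB => M4 M40 sL qB.
move: qX qY rX rY n0 N0 nq Hb qB q0 rho0.
move: (en (sv b - sv z) ^+ 2) (qnorm _) (_ ^+ 2) => rho q N.
move: (crossX _ (sv b) _ _) (crossY _ (sv b) _ _) => X Y.
move: (crossX _ (sv (f b)) (sv c) _) (crossY _ (sv (f b)) (sv c) _) => X' Y'.
move: (crossX _ _ (sv b) _) (crossY _ _ (sv b) _) => Xs Ys.
move=> qX qY rX rY n0 N0 nq Hb qB q0 rho0.
(* [h] is the modulus of the quotient of the two cross ratios, freed of the factor [N]. *)
pose h : R := r * (X ^+ 2 + Y ^+ 2) / N.
have h0 : 0 < h by rewrite divr_gt0 // mulr_gt0.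
have XsE : Xs = h * cos L.
  apply: (mulfI (lt0r_neq0 N0)); rewrite -qX rX rY /h.
  by field; rewrite lt0r_neq0.
have YsE : Ys = h * sin L.
  apply: (mulfI (lt0r_neq0 N0)); rewrite -qY rX rY /h.
  by field; rewrite lt0r_neq0.
have hq : h = q.
  apply/eqP; rewrite -(@eqrXn2 _ 2) ?(ltW h0) //; apply/eqP; rewrite -nq XsE YsE !exprMn -mulrDr cs.
  by rewrite mulr1.
have eta_rho : 0 <= eta * rho by rewrite mulr_ge0 // ltW.
case: Hb; rewrite ?XsE ?YsE; last first.
  by have := mulr_ge0 (ltW h0) cL; lra.
rewrite normrM (gtr0_norm h0) hq ltNge => /negP; apply.
apply: le_trans (ler_wpM2r (normr_ge0 _) qB) _.
by rewrite mulrAC ler_wpM2r // mulrC.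
Qed.

Lemma turning_constant_sign : exists2 ka : R, 0 < ka & exists2 r : R, 0 < r &
  exists s : bool, forall b : S2 R, b <> z -> en (sv b - sv z) < r ->
    valid z b c d /\ ka <= (-1) ^+ s * turning wf z b c d.
Proof.
have [ka ka0 [r0 r00 H]] := turning_gap.
(* [cap_path] may enlarge the radius eight times, and the path must stay where [turning_gap]
   applies. *)
exists ka => //; pose r := Num.min (1 / 8) (r0 / 16).
have rp : 0 < r by rewrite lt_min !divr_gt0.
have r8 : r <= 1 / 8 by rewrite ge_min lexx.
have r16 : r <= r0 / 16 by rewrite ge_min lexx orbT.
exists r => //.
have nosign b0 b1 : b0 <> z -> b1 <> z -> en (sv b0 - sv z) < r -> en (sv b1 - sv z) < r ->
    0 < turning wf z b0 c d -> 0 < turning wf z b1 c d.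
  move=> n0 n1 h0 h1 t0; have [P [cP P0 P1 HP]] := cap_path _ _ _ _ r8 n0 n1 h0 h1.
  rewrite ltNge; apply/negP => t1.
  have HP' s : s \in `[0, 1]%R -> valid z (P s) c d /\ ka < `|turning wf z (P s) c d|.
    by move=> /HP[Pz Pr]; apply: H => //; lra.
  pose F s := turning wf z (P s) c d.
  have cF : {within `[0, 1], continuous F}.
    apply: continuous_in_subspaceT => s; rewrite inE => /= s01.
    have [va _] := HP' s s01.
    by apply: (turning_cont _ (fun=> z) P (fun=> c) (fun=> d)) => //; exact: path_cont_cst.
  have [|s s01 Fs] := @IVT R F 0 1 0 ler01 cF.
    by rewrite ge_min le_max /F P0 P1 t1 (ltW t0) orbT.
  by have [_] := HP' s s01; rewrite -/(F s) Fs normr0 => h; have := lt_trans ka0 h; rewrite ltxx.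
have [[b0 [n0 h0 t0]]|none] := pselect (exists b0, [/\ b0 <> z, en (sv b0 - sv z) < r & 0 < turning wf z b0 c d]).
  exists false => b bz br; rewrite expr0 mul1r.
  have [|va hk] := H b bz; first by lra.
  have t1 := nosign b0 b n0 bz h0 br t0; split => //.
  by move: hk; rewrite gtr0_norm // => /ltW.
exists true => b bz br; rewrite expr1 mulN1r.
have [|va hk] := H b bz; first by lra.
split => //; have t1 : turning wf z b c d <= 0.
  by rewrite leNgt; apply/negP => t1; apply: none; exists b.
by move: hk; rewrite ler0_norm // => /ltW.
Qed.

Fixpoint word_pow (n : nat) : seq (S2 R -> S2 R) := if n is n'.+1 then wf ++ word_pow n' else [::].

Lemma compose_word_pow n : compose (word_pow n) = iter n f.
Proof. by elim: n => //= n IH; rewrite compose_cat cwf IH. Qed.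

Lemma all_small_word_pow n : all_small (word_pow n).
Proof. by elim: n => //= n IH; exact: all_small_cat. Qed.

(** [turning_unique] asks for [b] and [c] to be linearly independent. Of two points on opposite
    sides of [z] along one great circle, one will do: otherwise [c] would be parallel to both [z]
    and [w]. *)
Lemma generic_start (e : R) : 0 < e -> exists b : S2 R,
  [/\ b <> z, en (sv b - sv z) < e & crossp (sv c) (sv b) != 0].
Proof.
move=> e0; have [w [w1 zw]] := exists_orthogonal (sv z).
pose t := Num.min (1 / 2) (e / 4).
have t0 : 0 < t by rewrite lt_min !divr_gt0.
have t1 : t <= 1 / 2 by rewrite ge_min lexx.
have te : t <= e / 4 by rewrite ge_min lexx orbT.
have nw1 : dotp (- w) (- w) = 1 by rewrite !dotpL opprK.
have znw : dotp (sv z) (- w) = 0 by rewrite !dotpL zw oppr0.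
have st : 0 < sin t by apply: sin2_gt0; lra.
have ct : 0 < cos t by apply: cos_gt0_pihalf; have := pihalf_ge1 R; lra.
have nz (v : V R) v1 zv : arcS2 (sv z) v (sv_unit z) v1 zv t <> z.
  move=> h; have := congr1 (fun x : S2 R => dotp (sv x) v) h.
  have -> : dotp (sv (arcS2 (sv z) v (sv_unit z) v1 zv t)) v = sin t.
    by rewrite /= /gcarc !dotpL zv v1; ring.
  by rewrite zv => h0; move: st; rewrite h0 ltxx.
have sm (v : V R) v1 zv : en (sv (arcS2 (sv z) v (sv_unit z) v1 zv t) - sv z) < e.
  by have := en_arc_le _ _ t (sv_unit z) v1 zv (ltW t0); rewrite /=; lra.
have [h1|h1] := eqVneq (crossp (sv c) (gcarc (sv z) w t)) 0; last first.
  by exists (arcS2 (sv z) w (sv_unit z) w1 zw t); split => //.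
have [h2|h2] := eqVneq (crossp (sv c) (gcarc (sv z) (- w) t)) 0; last first.
  by exists (arcS2 (sv z) (- w) (sv_unit z) nw1 znw t); split => //.
exfalso.
have E1 : crossp (sv c) (gcarc (sv z) w t) = cos t *: crossp (sv c) (sv z) + sin t *: crossp (sv c) w.
  by apply: vec3P; rewrite !mxE /=; ring.
have E2 : crossp (sv c) (gcarc (sv z) (- w) t) = cos t *: crossp (sv c) (sv z) - sin t *: crossp (sv c) w.
  by apply: vec3P; rewrite !mxE /=; ring.
rewrite E1 in h1; rewrite E2 in h2.
have [cz cw] : crossp (sv c) (sv z) = 0 /\ crossp (sv c) w = 0.
  have z2 : (2 * cos t) *: crossp (sv c) (sv z) = 0.
    apply: etrans (etrans (f_equal2 (fun x y => x + y) h1 h2) (addr0 _)).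
    by apply: vec3P; rewrite !mxE /=; ring.
  have w2 : (2 * sin t) *: crossp (sv c) w = 0.
    apply: etrans (etrans (f_equal2 (fun x y => x - y) h1 h2) (subrr _)).
    by apply: vec3P; rewrite !mxE /=; ring.
  have n1 : 2 * cos t != 0 by rewrite lt0r_neq0 // mulr_gt0.
  have n2 : 2 * sin t != 0 by rewrite lt0r_neq0 // mulr_gt0.
  move/eqP: z2; rewrite scaler_eq0 (negbTE n1) /= => /eqP z2.
  by move/eqP: w2; rewrite scaler_eq0 (negbTE n2) /= => /eqP w2.
have gram (x y : V R) : dotp (crossp x y) (crossp x y) = dotp x x * dotp y y - dotp x y ^+ 2.
  by rewrite !dotpE !mxE /=; ring.
have d0 : dotp (0 : V R) 0 = 0 by apply/eqP; rewrite dotp_eq0.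
have := gram (sv c) (sv z); have := gram (sv c) w; rewrite cz cw d0 !sv_unit w1 => g1 g2.
(* Bessel's inequality: the squares of [<c, z>] and [<c, w>] add up to at most [1], yet each equals
   [1]. *)
have := dotp_ge0 (sv c - dotp (sv c) (sv z) *: sv z - dotp (sv c) w *: w).
rewrite !dotpL !sv_unit w1 (dotpC (sv z) (sv c)) (dotpC w (sv c)) (dotpC w (sv z)) zw.
by move: g1 g2; lra.
Qed.

Lemma rotation_contradiction :
  (forall e : R, 0 < e -> exists N, forall n, (N <= n)%N ->
    exists w, [/\ all_small w, compose w = iter n f & (size w)%:R <= e * n%:R]) -> False.
Proof.
move=> H; have M1' := M1; have [ka ka0 [r r0 [s Hs]]] := turning_constant_sign.
(* A letter turns by at most [2], so a word of length [ka n / 4] turns by at most [ka n / 2], less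
   than the [ka n] accumulated along the orbit. *)
have k4 : 0 < ka / 4 by rewrite divr_gt0.
have [N HN] := H _ k4.
have [w [aw cw sw]] := HN N.+1 (leqnSn N); set n := N.+1 in cw sw.
have Mn0 : 0 < M ^+ n by rewrite exprn_gt0 //; lra.
have [b [bz br bc]] := generic_start (r / M ^+ n) (divr_gt0 r0 Mn0).
have itz j : iter j f z = z by elim: j => //= j ->.
have itc j : iter j f c = c by elim: j => //= j ->.
have itd j : iter j f d = d by elim: j => //= j ->.
have itb j : iter j f b <> z by elim: j => //= j IH; move=> h; apply: IH; apply: finj; rewrite h fz.
have itl j : en (sv (iter j f b) - sv z) <= M ^+ j * en (sv b - sv z).
  elim: j => [|j IH]; first by rewrite mul1r.
  rewrite exprS -mulrA; apply: le_trans (lipf _) _.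
  by rewrite ler_wpM2l //; lra.
have itr j : (j <= n)%N -> en (sv (iter j f b) - sv z) < r.
  move=> jn; apply: le_lt_trans (itl j) _; move: br; rewrite ltr_pdivlMr //.
  apply: le_lt_trans; rewrite mulrC ler_wpM2l ?en_ge0 //.
  by rewrite ler_weXn2l.
have lower j : (j <= n)%N -> ka * j%:R <= (-1) ^+ s * turning (word_pow j) z b c d.
  elim: j => [_|j IH jn]; first by rewrite mulr0 mulr0.
  rewrite /= turning_cat compose_word_pow itz itc itd mulrDr.
  have [_ h] := Hs _ (itb j) (itr j (ltnW jn)).
  by have := IH (ltnW jn); rewrite -[j.+1%:R]natr1; lra.
have va : valid z b c d by have [] := Hs b bz (itr 0%N isT).
have E : turning (word_pow n) z b c d = turning w z b c d.
  apply: turning_unique => //; first exact: all_small_word_pow.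
  by rewrite compose_word_pow cw.
have := lower n (leqnn n); rewrite E.
have := turning_bound w z b c d.
have : (-1) ^+ s * turning w z b c d <= `|turning w z b c d|.
  by apply: le_trans (ler_norm _) _; rewrite normrM normrX normrN1 expr1n mul1r.
have : 0 < ka * n%:R by rewrite mulr_gt0 // ltr0n.
by move: sw; lra.
Qed.

End TurningGap.

(** * Eigenvalues of the derivative *)

(** In the basis [u], [v = z x u] of the tangent plane the map is upper triangular: the nonnegative
    eigenvalue is [1], and the other diagonal entry [q] is positive by orientation and has modulus
    [1] as an eigenvalue. *)
Lemma unipotent_conclusion (R : realType) (z : V R) (A : {linear V R -> V R}) :
  dotp z z = 1 ->
  (forall u, dotp u u = 1 -> tangent z u -> tangent z (A u)) ->
  (forall u (mu : R), dotp u u = 1 -> tangent z u -> A u = mu *: u -> `|mu| = 1) ->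
  (forall e1 e2, dotp e1 e1 = 1 -> dotp e2 e2 = 1 -> dotp e1 e2 = 0 -> tangent z e1 -> tangent z e2 ->
     0 < triple z e1 e2 -> 0 < triple z (A e1) (A e2)) ->
  (exists u, [/\ dotp u u = 1, tangent z u, triple z u (A u) = 0 & 0 <= dotp u (A u)]) ->
  (exists u : V R, [/\ tangent z u, u != 0 & A u = u]) /\
  (forall (a b : R) (u w : V R), tangent z u -> tangent z w -> (u != 0 \/ w != 0) ->
       A u = a *: u - b *: w -> A w = b *: u + a *: w -> a = 1 /\ b = 0).
Proof.
move=> z1 tA eigA jA [u [u1 zu I0 R0]].
have zAu := tA _ u1 zu.
have lagrange (x y : V R) : dotp (crossp x y) (crossp x y) = dotp x x * dotp y y - dotp x y ^+ 2.
  by rewrite !dotpE !mxE /=; ring.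
have AZ (k : R) x : A (k *: x) = k *: A x by rewrite linearZ.
have AD x y : A (x + y) = A x + A y by rewrite linearD.
have Au : A u = dotp u (A u) *: u.
  apply/eqP; rewrite -subr_eq0 -dotp_eq0; apply/eqP.
  have c0 : crossp u (A u) = 0 by rewrite (crossp_tangent _ _ _ z1 zu zAu) I0 scale0r.
  have := lagrange u (A u); rewrite c0 u1.
  have -> : dotp (0 : V R) 0 = 0 by apply/eqP; rewrite dotp_eq0.
  rewrite !dotpL u1 (dotpC (A u) u); move: (dotp u (A u)) (dotp (A u) (A u)) => x y.
  by rewrite expr2; lra.
have mu1 := eigA _ _ u1 zu Au; rewrite ger0_norm // in mu1.
rewrite mu1 scale1r in Au.
split; first by exists u; split => //; exact: unit_neq0.
pose v := crossp z u.
have v1 : dotp v v = 1 by rewrite /v lagrange z1 u1 zu; ring.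
have zv : tangent z v by rewrite /tangent /v !dotpE !mxE /=; ring.
have uv : dotp u v = 0 by rewrite /v !dotpE !mxE /=; ring.
have zuv : triple z u v = 1.
  by rewrite -v1 /v tripleE !dotpE !mxE /=; ring.
have decomp x : tangent z x -> x = dotp x u *: u + dotp x v *: v.
  move=> zx; apply/eqP; rewrite -subr_eq0 -dotp_eq0; apply/eqP.
  have gram : dotp x v ^+ 2 =
      dotp x x * dotp z z * dotp u u + dotp z x * dotp z u * dotp x u *+ 2
      - dotp x x * dotp z u ^+ 2 - dotp u u * dotp z x ^+ 2
      - dotp z z * dotp x u ^+ 2.
    by rewrite /v !dotpE !mxE /=; ring.
  move: gram; rewrite z1 u1 zu zx.
  rewrite !dotpL (dotpC u x) (dotpC v x) (dotpC v u) uv v1 u1 !expr2.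
  by move: (dotp x x) (dotp x u) (dotp x v) => p q r; lra.
clearbody v.
have Av := decomp _ (tA _ v1 zv).
move: (dotp (A v) u) (dotp (A v) v) Av => p q Av.
have q0 : 0 < q.
  have t01 : 0 < triple z u v by rewrite zuv.
  have := jA _ _ u1 v1 uv zu zv t01; rewrite Au Av.
  have -> : triple z u (p *: u + q *: v) = q * triple z u v by rewrite !tripleE !mxE; ring.
  by rewrite zuv mulr1.
have q1 : q = 1.
  have [//|nq] := eqVneq q 1.
  (* If [q] were not [1], this would be an eigenvector for [q]. *)
  pose x := p *: u + (q - 1) *: v.
  have x0 : x != 0.
    apply/eqP => h; have : dotp x v = 0 by rewrite h dotpE !mxE !mul0r !addr0.
    by rewrite /x !dotpL uv v1 mulr0 add0r mulr1 => /subr0_eq h'; rewrite h' eqxx in nq.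
  have Ax : A x = q *: x.
    rewrite /x AD !AZ Au Av; apply: vec3P; rewrite !mxE; ring.
  have := eigA _ q (normalized_dotp _ x0); rewrite AZ Ax !scalerA (mulrC q) ger0_norm ?(ltW q0) //.
  by apply => //; rewrite /tangent /x !dotpL zu zv !mulr0 addr0 mulr0.
rewrite q1 scale1r in Av.
move=> a b x y zx zy xy.
have xE := decomp _ zx; have yE := decomp _ zy.
move: xE yE; move: (dotp x u) (dotp x v) (dotp y u) (dotp y v) => x1 x2 y1 y2 xE yE.
have coord (s t s' t' : R) : s *: u + t *: v = s' *: u + t' *: v -> s = s' /\ t = t'.
  move=> h; split.
    by have := congr1 (fun w => dotp w u) h; rewrite /= !dotpL u1 (dotpC v) uv !mulr0 !addr0 !mulr1.
  by have := congr1 (fun w => dotp w v) h; rewrite /= !dotpL v1 uv !mulr0 !add0r !mulr1.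
rewrite xE yE !AD !AZ Au Av => hx hy.
have [ex1 ex2] : x1 + x2 * p = a * x1 - b * y1 /\ x2 = a * x2 - b * y2.
  by apply: coord; apply: etrans (etrans hx _); apply: vec3P; rewrite !mxE; ring.
have [ey1 ey2] : y1 + y2 * p = b * x1 + a * y1 /\ y2 = b * x2 + a * y2.
  by apply: coord; apply: etrans (etrans hy _); apply: vec3P; rewrite !mxE; ring.
(* The determinant of the linear system for the [v]-coordinates of [x] and [y]. If it is nonzero
   these vanish, and then the [u]-coordinates solve the same system. *)
have [n0|n0] := eqVneq ((a - 1) ^+ 2 + b ^+ 2) 0.
  move/eqP: n0; rewrite paddr_eq0 ?sqr_ge0 // !sqrf_eq0 subr_eq0.
  by case/andP => /eqP -> /eqP ->.
exfalso.
have x20 : x2 = 0.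
  apply: (mulfI n0); rewrite mulr0.
  have -> : ((a - 1) ^+ 2 + b ^+ 2) * x2 = (a - 1) * (a * x2 - b * y2 - x2) + b * (b * x2 + a * y2 - y2) by ring.
  by rewrite -ex2 -ey2 !subrr !mulr0 addr0.
have y20 : y2 = 0.
  apply: (mulfI n0); rewrite mulr0.
  have -> : ((a - 1) ^+ 2 + b ^+ 2) * y2 = (a - 1) * (b * x2 + a * y2 - y2) - b * (a * x2 - b * y2 - x2) by ring.
  by rewrite -ex2 -ey2 !subrr !mulr0 subr0.
rewrite x20 mul0r addr0 in ex1; rewrite y20 mul0r addr0 in ey1.
have x10 : x1 = 0.
  apply: (mulfI n0); rewrite mulr0.
  have -> : ((a - 1) ^+ 2 + b ^+ 2) * x1 = (a - 1) * (a * x1 - b * y1 - x1) + b * (b * x1 + a * y1 - y1) by ring.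
  by rewrite -ex1 -ey1 !subrr !mulr0 addr0.
have y10 : y1 = 0.
  apply: (mulfI n0); rewrite mulr0.
  have -> : ((a - 1) ^+ 2 + b ^+ 2) * y1 = (a - 1) * (b * x1 + a * y1 - y1) - b * (a * x1 - b * y1 - x1) by ring.
  by rewrite -ex1 -ey1 !subrr !mulr0 subr0.
by move: xy; rewrite xE yE x10 x20 y10 y20 !scale0r addr0 eqxx; case.
Qed.

Lemma two_other_points (T : Type) (P : T -> Prop) (z z1 z2 z3 : T) : P z1 -> P z2 -> P z3 ->
  z1 <> z2 -> z1 <> z3 -> z2 <> z3 -> exists c d, [/\ P c, P d & [/\ z <> c, z <> d & c <> d]].
Proof.
move=> P1 P2 P3 n12 n13 n23.
have [e1|e1] := pselect (z = z1).
  by exists z2, z3; rewrite e1.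
have [e2|e2] := pselect (z = z2).
  by exists z1, z3; split => //; split => //; rewrite e2 => h; apply: n23.
by exists z1, z2.
Qed.

Theorem theoremB (R : realType) (f : S2 R -> S2 R) :
  distortion f ->
  (exists z1 z2 z3 : S2 R, [/\ f z1 = z1, f z2 = z2 & f z3 = z3] /\
                            [/\ z1 <> z2, z1 <> z3 & z2 <> z3]) ->
  forall z : S2 R, f z = z ->
  forall (U : set (V R)) (g : V R -> V R), extends f U g ->
    (* 1 is an eigenvalue of Df(z) on T_z S^2 *)
    (exists u : V R, [/\ tangent (proj1_sig z) u, u != 0 & 'd g (proj1_sig z) u = u]) /\
    (* every (complex) eigenvalue a + i b of Df(z) on T_z S^2 equals 1 *)
    (forall (a b : R) (u w : V R), tangent (proj1_sig z) u -> tangent (proj1_sig z) w ->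
       (u != 0 \/ w != 0) ->
       'd g (proj1_sig z) u = a *: u - b *: w ->
       'd g (proj1_sig z) w = b *: u + a *: w -> a = 1 /\ b = 0).
Proof.
move=> df [z1 [z2 [z3 [[f1 f2 f3] [n12 n13 n23]]]]] z fz U g eg.
have [c [d [fc fd [zc zd cd]]]] := two_other_points _ (fun x => f x = x) z _ _ _ f1 f2 f3 n12 n13 n23.
have [D10 _ _] := df.
have dg := extends_diff f U g z eg.
apply: (unipotent_conclusion R (proj1_sig z) ('d g (proj1_sig z)) (sv_unit z)).
- move=> u u1 zu; have := tangent_diff f U g z u u1 zu eg; rewrite fz; exact.
- move=> u mu u1 zu Au; exact: distortion_real_eigenvalue f z U g u mu df fz eg u1 zu Au.
- move=> e1 e2 e11 e22 e12 ze1 ze2 tp.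
  have := Diff10_jac_gt0 z e1 e2 e11 e22 e12 ze1 ze2 f U g tp D10 eg.
  by rewrite /jac fz; exact.
apply: contrapT => none.
have [wf [awf cwf]] := Diff10_generated f D10.
apply: (rotation_contradiction f z c d fz fc fd zc zd cd wf awf cwf _ (distortion_words f df)).
apply: (quotient_gap f z d ('d g (proj1_sig z)) fz zd _ _ _ wf awf cwf).
- exact: diff_continuous.
- move=> e e0; have [r r0 H] := differentiable_expand g (proj1_sig z) e e0 dg.
  exists r; first exact: r0.
  by move=> b br; have := H (proj1_sig b) br; rewrite !eg.2 fz; exact.
- move=> u u1 zu I0; rewrite ltNge; apply/negP => R0; apply: none.
  by exists u; split; [exact: u1|exact: zu|exact: I0|exact: R0].
Qed.
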